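(* Let $\mathcal{A}\subset\bar{\mathbb{Q}}$ be a finite set of algebraic integers that does not contain any roots of unity, and let $m\ge 2$ and $n\ge 1$ be integers. Then for all integers $J\ge1$ we have $$\sum_{\alpha\in\mathcal{A}}h(\alpha)\ \ge\ \frac{3}{J+2}\left(\Delta(\mathcal{A},m,n)\log m-\frac{|\mathcal{A}|}{n}\cdot\frac{\log(J/2+1)+1}{J}\right).$$
   Context: For a number field $K$, $M_K$ is the set of absolute values on $K$ extending the usual absolute values of $\mathbb{Q}$, and $M_K^0$ is the subset of nonarchimedean ones. For $\alpha\in K$ and $v\in M_K$ set $\|\alpha\|_v=|\alpha|_v^{[K_v:\mathbb{Q}_v]/[K:\mathbb{Q}]}$ and $v(\alpha)=-\log\|\alpha\|_v$. The absolute logarithmic height is $h(\alpha)=\sum_{v\in M_K}\max\{\log\|\alpha\|_v,0\}$. For a finite set $\mathcal{A}$ of algebraic integers, define $$\Delta(\mathcal{A},m,n)=\sum_{\alpha\in\mathcal{A}}\frac{1}{\log m}\sum_{v\mid m}\frac1n\,v(\alpha^n-1),$$ where the inner sum is over all $v\in M_K^0$ with $v\mid m$ and $K$ is any number field containing $\mathcal{A}$ (the value is independent of the choice of $K$). *)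

(* Defs.v *)
From HB Require Import structures.
From mathcomp Require Import all_boot all_order all_algebra all_field finmap.
From mathcomp Require Import ring_quotient.
From mathcomp Require Import all_classical all_reals exp.

Set Implicit Arguments.
Unset Strict Implicit.
Unset Printing Implicit Defensive.

Import Order.TTheory GRing.Theory Num.Theory.

Local Open Scope classical_set_scope.
Local Open Scope ring_scope.

Record absval (R : realType) (K : fieldType) := Absval {
  absval_fun :> K -> R;
  absval_ge0 : forall x, 0 <= absval_fun x;
  absval_eq0 : forall x, (absval_fun x == 0) = (x == 0);
  absvalM : {morph absval_fun : x y / x * y};
  ler_absvalD : forall x y, absval_fun (x + y) <= absval_fun x + absval_fun y
}.

HB.instance Definition _ (R : realType) (K : fieldType) :=
  gen_eqMixin (absval R K).
HB.instance Definition _ (R : realType) (K : fieldType) :=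
  gen_choiceMixin (absval R K).

Section AbsvalTheory.
Context {R : realType} {K : fieldType}.
Implicit Type v : absval R K.

Lemma absval0 v : v 0 = 0.
Proof. by apply/eqP; rewrite absval_eq0. Qed.

Lemma absval_gt0 v x : (0 < v x) = (x != 0).
Proof. by rewrite lt_def absval_ge0 andbT absval_eq0. Qed.

Lemma absval1 v : v 1 = 1.
Proof.
have v1 : v 1 != 0 by rewrite absval_eq0 oner_eq0.
by apply: (mulfI v1); rewrite -absvalM !mulr1.
Qed.

Lemma absvalN v x : v (- x) = v x.
Proof.
have vN1 : v (-1) = 1.
  by apply/eqP; rewrite -sqrp_eq1 ?absval_ge0// expr2 -absvalM mulrNN mulr1 absval1.
by rewrite -mulN1r absvalM vN1 mul1r.
Qed.

Lemma absvalV v x : v x^-1 = (v x)^-1.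
Proof.
have [->|x0] := eqVneq x 0; first by rewrite invr0 absval0 invr0.
have vx0 : v x != 0 by rewrite absval_eq0.
by apply: (mulfI vx0); rewrite -absvalM !divff// absval1.
Qed.

Lemma absvalBC v x y : v (x - y) = v (y - x).
Proof. by rewrite -absvalN opprB. Qed.

Lemma ler_absvalB v x y : v x - v y <= v (x - y).
Proof. by rewrite lerBlDr -{1}(subrK y x) ler_absvalD. Qed.

End AbsvalTheory.

Section AbsvalComp.
Context {R : realType} {F K : fieldType} (f : {rmorphism F -> K}).
Variable v : absval R K.

Fact absval_comp_eq0 x : (v (f x) == 0) = (x == 0).
Proof. by rewrite absval_eq0 fmorph_eq0. Qed.
Fact absval_compM : {morph v \o f : x y / x * y}.
Proof. by move=> x y /=; rewrite rmorphM absvalM. Qed.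
Fact absval_compD x y : v (f (x + y)) <= v (f x) + v (f y).
Proof. by rewrite rmorphD ler_absvalD. Qed.

Definition absval_comp : absval R F := @Absval R F (v \o f)
  (fun x => absval_ge0 v (f x)) absval_comp_eq0 absval_compM absval_compD.

End AbsvalComp.

(* The completion of (K, v): the ring of v-Cauchy sequences modulo the ideal  *)
(* of sequences tending to 0.                                                 *)
Section Completion.
Context {R : realType} {K : fieldType}.
Implicit Type v : absval R K.

Definition cauchy_seq v (x : nat -> K) : Prop := forall e : R, 0 < e ->
  exists N, forall i j, (N <= i)%N -> (N <= j)%N -> v (x i - x j) < e.

Definition null_seq v (x : nat -> K) : Prop := forall e : R, 0 < e ->
  exists N, forall i, (N <= i)%N -> v (x i) < e.

Lemma cauchy_seq_bounded v x : cauchy_seq v x ->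
  exists2 M : R, 0 < M & forall i, v (x i) <= M.
Proof.
move=> /(_ 1 ltr01)[N xN].
pose S := \sum_(i < N.+1) v (x i).
have S0 : 0 <= S by apply: sumr_ge0 => i _; exact: absval_ge0.
have xS i : (i <= N)%N -> v (x i) <= S.
  move=> iN; rewrite /S (bigD1 (Ordinal (iN : (i < N.+1)%N)))//= lerDl.
  by apply: sumr_ge0 => j _; exact: absval_ge0.
exists (S + 1); first by rewrite ltr_wpDl.
move=> i; have [iN|/ltnW Ni] := leqP i N; first by rewrite ler_wpDr ?xS.
rewrite -(subrK (x N) (x i)) (le_trans (ler_absvalD _ _ _))// addrC lerD ?xS//.
exact/ltW/xN.
Qed.

Definition cauchy_pred v : {pred nat -> K} := fun x => `[< cauchy_seq v x >].

Fact cauchy_subring_closed v : subring_closed (cauchy_pred v).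
Proof.
split.
- by apply/asboolP => e e0; exists 0%N => i j _ _; rewrite subrr absval0.
- move=> x y /asboolP cx /asboolP cy; apply/asboolP => e e0.
  have e20 : 0 < e / 2 by rewrite divr_gt0.
  have [N xN] := cx _ e20; have [M yM] := cy _ e20.
  exists (maxn N M) => i j; rewrite !geq_max => /andP[Ni Mi] /andP[Nj Mj].
  have -> : (x - y) i - (x - y) j = (x i - x j) + (y j - y i).
    by rewrite !fctE opprB addrACA [RHS]addrACA [- x j - y i]addrC.
  rewrite (le_lt_trans (ler_absvalD _ _ _))// [e]splitr ltrD//; first exact: xN.
  exact: yM.
- move=> x y /asboolP cx /asboolP cy; apply/asboolP => e e0.
  have [A A0 xA] := cauchy_seq_bounded cx.
  have [B B0 yB] := cauchy_seq_bounded cy.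
  have [|N xN] := cx (e / 2 / B); first by rewrite !divr_gt0.
  have [|M yM] := cy (e / 2 / A); first by rewrite !divr_gt0.
  exists (maxn N M) => i j; rewrite !geq_max => /andP[Ni Mi] /andP[Nj Mj].
  have -> : (x * y) i - (x * y) j = (x i - x j) * y i + x j * (y i - y j).
    by rewrite !fctE mulrBl mulrBr addrA subrK.
  rewrite (le_lt_trans (ler_absvalD _ _ _))// !absvalM [e]splitr ltrD//.
  + rewrite (@le_lt_trans _ _ (v (x i - x j) * B))//.
      by rewrite ler_wpM2l ?absval_ge0.
    by rewrite -ltr_pdivlMr ?xN.
  + rewrite (@le_lt_trans _ _ (A * v (y i - y j)))//.
      by rewrite ler_wpM2r ?absval_ge0.
    by rewrite mulrC -ltr_pdivlMr ?yM.
Qed.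

HB.instance Definition _ v :=
  GRing.isSubringClosed.Build (nat -> K) (cauchy_pred v)
    (cauchy_subring_closed v).

Record cauchy v := Cauchy {
  cauchy_val :> nat -> K;
  cauchy_valP : cauchy_val \in cauchy_pred v }.

HB.instance Definition _ v := [isSub for @cauchy_val v].
HB.instance Definition _ v := [Choice of cauchy v by <:].
HB.instance Definition _ v := [SubChoice_isSubComNzRing of cauchy v by <:].

Lemma cauchyP v (x : cauchy v) : cauchy_seq v x.
Proof. exact/asboolP/(cauchy_valP x). Qed.

Definition null_ideal v : cauchy v -> bool := fun x => `[< null_seq v x >].
Arguments null_ideal : clear implicits.

Fact null_idealr_closed v : idealr_closed (null_ideal v).
Proof.
split.
- by apply/asboolP => e e0; exists 0%N => i _; rewrite absval0.
- apply/negP => /asboolP/(_ 1 ltr01)[N /(_ N (leqnn _))].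
  by rewrite absval1 ltxx.
- move=> a x y /asboolP nx /asboolP ny; apply/asboolP => e e0.
  have [A A0 aA] := cauchy_seq_bounded (cauchyP a).
  have [|N xN] := nx (e / 2 / A); first by rewrite !divr_gt0.
  have [|M yM] := ny (e / 2); first by rewrite !divr_gt0.
  exists (maxn N M) => i; rewrite !geq_max => /andP[Ni Mi].
  rewrite (le_lt_trans (ler_absvalD _ _ _))// [e]splitr ltrD ?yM//.
  rewrite absvalM (@le_lt_trans _ _ (A * v (x i)))//.
    by apply: ler_wpM2r (aA i); exact: absval_ge0.
  by rewrite mulrC -ltr_pdivlMr ?xN.
Qed.

HB.instance Definition _ v :=
  isIdealr.Build (cauchy v) (null_ideal v) (null_idealr_closed v).

Definition null_idealr v : idealr (cauchy v) := null_ideal v.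

Definition completion v : Type := {ideal_quot (null_idealr v)}.

HB.instance Definition _ v := GRing.ComNzRing.on (completion v).

Definition cauchy_lim v (x : cauchy v) : completion v :=
  (\pi_{ideal_quot (null_idealr v)} x)%qT.

Fact cauchy_lim_zmod_morphism v : zmod_morphism (@cauchy_lim v).
Proof. exact: (rmorphB \pi_{ideal_quot (null_idealr v)}%qT). Qed.

Fact cauchy_lim_monoid_morphism v : monoid_morphism (@cauchy_lim v).
Proof.
split; first exact: (rmorph1 \pi_{ideal_quot (null_idealr v)}%qT).
exact: (rmorphM \pi_{ideal_quot (null_idealr v)}%qT).
Qed.

HB.instance Definition _ v := GRing.isZmodMorphism.Build _ _ (@cauchy_lim v)
  (@cauchy_lim_zmod_morphism v).
HB.instance Definition _ v := GRing.isMonoidMorphism.Build _ _ (@cauchy_lim v)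
  (@cauchy_lim_monoid_morphism v).

Lemma cauchy_lim_eq v (x y : cauchy v) :
  (cauchy_lim x == cauchy_lim y) = (x - y \in null_ideal v).
Proof. by rewrite (Quotient.idealrBE (null_idealr v)). Qed.

Definition cauchy_repr v (x : completion v) : cauchy v :=
  repr (x : {ideal_quot (null_idealr v)}).

Lemma cauchy_reprK v : cancel (@cauchy_repr v) (@cauchy_lim v).
Proof. by move=> x; exact: (reprK (x : {ideal_quot (null_idealr v)})). Qed.

Lemma cauchy_inv_subproof v (x : cauchy v) : x \notin null_ideal v ->
  exists y : cauchy v, y * x - 1 \in null_ideal v.
Proof.
move=> /asboolPn nx.
have [d d0 [N xN]] : exists2 d : R, 0 < d &
    exists N, forall i, (N <= i)%N -> d <= v (x i).
  apply: contrapT => xd; apply: nx => e e0.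
  have e20 : 0 < e / 2 by rewrite divr_gt0.
  have [N xN] := cauchyP x e20.
  have [i Ni xi] : exists2 i, (N <= i)%N & v (x i) < e / 2.
    apply: contrapT => xi; apply: xd; exists (e / 2) => //.
    exists N => i Ni; rewrite leNgt; apply/negP => ?; by apply: xi; exists i.
  exists N => j Nj; rewrite -(subrK (x i) (x j)).
  by rewrite (le_lt_trans (ler_absvalD _ _ _))// [e]splitr ltrD ?xN.
have x0 i : (N <= i)%N -> x i != 0.
  by move=> Ni; rewrite -(absval_gt0 v) (lt_le_trans d0)// xN.
have cy : (fun i => (x i)^-1) \in cauchy_pred v.
  apply/asboolP => e e0.
  have [|M xM] := cauchyP x (e := e * (d * d)); first by rewrite !mulr_gt0.
  exists (maxn N M) => i j; rewrite !geq_max => /andP[Ni Mi] /andP[Nj Mj].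
  have -> : (x i)^-1 - (x j)^-1 = (x j - x i) / (x i * x j).
    by rewrite invfM mulrBl mulrCA divff ?x0// mulr1 mulrA divff ?x0// mul1r.
  rewrite absvalM absvalV absvalM ltr_pdivrMr; last first.
    by rewrite mulr_gt0 ?absval_gt0 ?x0.
  rewrite (lt_le_trans (xM _ _ Mj Mi))// ler_pM2l// ler_pM ?xN//; exact: ltW.
exists (Cauchy cy); apply/asboolP => e e0; exists N => i Ni.
have -> : (Cauchy cy * x - 1 : cauchy v) i = (x i)^-1 * x i - 1 by [].
by rewrite mulVf ?x0// subrr absval0.
Qed.

Definition completion_inv v (x : completion v) : completion v :=
  if x == 0 then 0 else xget 0 [set y | y * x = 1].

Fact completion_mulVf v (x : completion v) :
  x != 0 -> completion_inv x * x = 1.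
Proof.
move=> x0; rewrite /completion_inv (negbTE x0).
suff [y yx] : exists y, y * x = 1 by exact: (@xgetPex _ 0 [set y | y * x = 1]) (ex_intro _ y yx).
move: x0; rewrite -(cauchy_reprK x) -(rmorph0 (@cauchy_lim v)).
rewrite cauchy_lim_eq subr0 => /cauchy_inv_subproof[y].
rewrite -cauchy_lim_eq => /eqP yx; exists (cauchy_lim y).
by rewrite /= -(cauchy_lim_monoid_morphism v).2 yx (cauchy_lim_monoid_morphism v).1.
Qed.

Fact completion_inv0 v : completion_inv (0 : completion v) = 0.
Proof. by rewrite /completion_inv eqxx. Qed.

HB.instance Definition _ v := GRing.ComNzRing_isField.Build (completion v)
  (@completion_mulVf v) (@completion_inv0 v).

End Completion.

Arguments null_ideal {R K} v x.

(* The continuous extension F_(v o f) -> K_v of a field morphism f : F -> K.  *)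
Section CompletionMap.
Context {R : realType} {F K : fieldType} (f : {rmorphism F -> K}).
Variable v : absval R K.

Fact cauchy_map_subproof (x : cauchy (absval_comp f v)) :
  f \o x \in cauchy_pred v.
Proof.
apply/asboolP => e e0; have [N xN] := cauchyP x e0.
by exists N => i j Ni Nj; rewrite /= -rmorphB; exact: xN.
Qed.

Definition cauchy_map (x : cauchy (absval_comp f v)) : cauchy v :=
  Cauchy (cauchy_map_subproof x).

Fact cauchy_map_zmod_morphism : zmod_morphism cauchy_map.
Proof.
by move=> x y; apply/val_inj/funext => i; exact: rmorphB.
Qed.

Fact cauchy_map_monoid_morphism : monoid_morphism cauchy_map.
Proof.
split=> [|x y]; apply/val_inj/funext => i; first exact: rmorph1.
exact: rmorphM.
Qed.

HB.instance Definition _ := GRing.isZmodMorphism.Build _ _ cauchy_map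
  cauchy_map_zmod_morphism.
HB.instance Definition _ := GRing.isMonoidMorphism.Build _ _ cauchy_map
  cauchy_map_monoid_morphism.

Definition completion_map (x : completion (absval_comp f v)) : completion v :=
  cauchy_lim (cauchy_map (cauchy_repr x)).

Lemma completion_map_lim (x : cauchy (absval_comp f v)) :
  completion_map (cauchy_lim x) = cauchy_lim (cauchy_map x).
Proof.
apply/eqP; rewrite /completion_map cauchy_lim_eq -rmorphB.
have : cauchy_repr (cauchy_lim x) - x \in null_ideal (absval_comp f v).
  by rewrite -cauchy_lim_eq cauchy_reprK.
by move=> /asboolP nx; exact/asboolP.
Qed.

Fact completion_map_zmod_morphism : zmod_morphism completion_map.
Proof.
move=> x y; rewrite -(cauchy_reprK x) -(cauchy_reprK y).
by rewrite -rmorphB !completion_map_lim -rmorphB -rmorphB.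
Qed.

Fact completion_map_monoid_morphism : monoid_morphism completion_map.
Proof.
split=> [|x y].
  by rewrite -(rmorph1 (@cauchy_lim _ _ _)) completion_map_lim !rmorph1.
rewrite -(cauchy_reprK x) -(cauchy_reprK y).
by rewrite -rmorphM !completion_map_lim -rmorphM -rmorphM.
Qed.

HB.instance Definition _ := GRing.isZmodMorphism.Build _ _ completion_map
  completion_map_zmod_morphism.
HB.instance Definition _ := GRing.isMonoidMorphism.Build _ _ completion_map
  completion_map_monoid_morphism.

End CompletionMap.

Arguments completion_map {R F K} f v x.

Section NumberField.
Context {R : realType} {K : fieldExtType rat}.
Implicit Types (v : absval R K) (x : K).

Definition absval_rat v : absval R rat := absval_comp (in_alg K) v.

Section LocalModule.
Variable v : absval R K.

Definition completion_scale (a : completion (absval_rat v)) (y : completion v) :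
  completion v := completion_map (in_alg K) v a * y.

Fact completion_scaleA a b y :
  completion_scale a (completion_scale b y) = completion_scale (a * b) y.
Proof. by rewrite /completion_scale rmorphM mulrA. Qed.
Fact completion_scale1 : left_id 1 completion_scale.
Proof. by move=> y; rewrite /completion_scale rmorph1 mul1r. Qed.
Fact completion_scaleDr : right_distributive completion_scale +%R.
Proof. by move=> a y z; rewrite /completion_scale mulrDr. Qed.
Fact completion_scaleDl y : {morph completion_scale^~ y : a b / a + b}.
Proof. by move=> a b; rewrite /completion_scale rmorphD mulrDl. Qed.

HB.instance Definition _ := GRing.Zmodule_isLmodule.Build
  (completion (absval_rat v)) (completion v)
  completion_scaleA completion_scale1 completion_scaleDr completion_scaleDl.

End LocalModule.

(* [K_v : Q_v] *)
Definition local_degree v : nat :=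
  xget 0%N [set d | inhabited
    (Vector.axiom d (completion v : lmodType (completion (absval_rat v))))].

(* Normalised by |p|_p = 1/p. *)
Definition padic_abs (p : nat) (q : rat) : R :=
  if q == 0 then 0 else
  p%:R ^ ((logn p `|denq q|)%:Z - (logn p `|numq q|)%:Z).

Definition places : set (absval R K) := [set v |
  (forall q, absval_rat v q = ratr `|q|) \/
  (exists2 p, prime p & forall q, absval_rat v q = padic_abs p q)].

Definition nonarch_places : set (absval R K) := [set v | places v /\
  forall x y, v (x + y) <= Num.max (v x) (v y)].

Definition place_norm v x : R :=
  v x `^ ((local_degree v)%:R / (\dim {: K})%:R).

Definition place_val v x : R := - ln (place_norm v x).

(* As [ln 0 = 0] the element 0 contributes 0 at each place. *)
Definition height x : R :=
  \sum_(v \in places) Num.max (ln (place_norm v x)) 0.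

(* v | m means that m lies in the prime ideal of v. *)
Definition places_dvd (m : nat) : set (absval R K) :=
  [set v | nonarch_places v /\ v m%:R < 1].

End NumberField.

(* A number field inside Qbar is an abstract K together with an embedding     *)
(* iota into algC, the algebraic closure of Q; an algebraic number in iota(K) *)
(* is evaluated through its preimage in K.                                    *)
Section Qbar.
Context {R : realType} {K : fieldExtType rat} (iota : {rmorphism K -> algC}).

Definition emb_inv (a : algC) : K := xget 0 [set x | iota x = a].

Definition Qbar_height (a : algC) : R := height (emb_inv a).

Definition Delta (A : {fset algC}) (m n : nat) : R :=
  \sum_(a <- A) (ln m%:R)^-1 *
    \sum_(v \in places_dvd m) n%:R^-1 * place_val v (emb_inv a ^+ n - 1).

End Qbar.

(* Main.v *)
(* Let x in K be the preimage of alpha, y = x^n, and put                      *)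
(* P(y) = prod_{0 <= i < j <= J} (y^(j-i) - 1), an algebraic integer with     *)
(* J(J+1)/2 factors and degree J(J+1)(J+2)/6.  If v divides m, every factor   *)
(* of P(y) is a multiple of y - 1, so v(P(y)) >= J(J+1)/2 v(y - 1), and the   *)
(* product formula bounds the sum of v(P(y)) over these v by the average of   *)
(* log |sigma P(y)| over the complex embeddings sigma.  For |z| <= 1, P(z) is *)
(* up to sign a determinant of size J+1 whose entries are powers of z, so     *)
(* Hadamard's inequality gives |P(z)| <= (J+1)^((J+1)/2); the case |z| > 1    *)
(* follows through z -> 1/z.  Finally log(J+1) <= log(J/2+1) + 1.             *)
(*                                                                            *)
(* Of the product formula only one inequality is needed on each side:         *)
(* prod_v |b|_v^[K_v:Q_v] >= 1/|N(b)| over finitely many nonarchimedean v,    *)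
(* which is obtained by counting residue classes modulo b^k for k -> oo, and  *)
(* the fact that at most [K_v:Q_v] embeddings induce a given archimedean v.   *)
(* In both cases the local degree enters as the largest size of a family in K *)
(* on which v dominates the coordinates of rational combinations.             *)

(* What makes the estimate gain with J: at a place above m each of the J(J+1)/2 factors of P(y) is
   at least as divisible as y - 1, while in archimedean size P(y) costs only its degree
   J(J+1)(J+2)/6 times n h(alpha). The ratio of the two counts is (J+2)/3. The trivial bound |z^k -
   1| <= 2 on the unit disc would lose log 2 per factor whatever J is; the determinant bound reduces
   this loss to log(J+1)/J.

   The bound on P is [pow_diff_prod_le1] and [pow_diff_prod_ge1]. The norm is the determinant of a
   multiplication matrix, identified with the product over the embeddings by [det_mul_mx]. The two
   halves of the product formula are [nonarch_norm_bound] and [height_ge]; both rest on weak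
   approximation ([approximate_idempotents]) and on [local_degreeP], which turns the degree of
   completions into a statement about finite families in K. The estimate for one number is
   [place_val_sum_le], and the theorem sums it over [A]. *)
Require Import Defs.
From HB Require Import structures.
From mathcomp Require Import all_boot all_order all_algebra all_field finmap.
From mathcomp Require Import all_classical all_reals exp.
From mathcomp Require Import complex zify ring lra.

Set Implicit Arguments.
Unset Strict Implicit.
Unset Printing Implicit Defensive.

Import Order.TTheory GRing.Theory Num.Theory.
Import VectorInternalTheory Normc.

Local Open Scope ring_scope.

(** * A Vandermonde bound *)

(** With A^H the conjugate transpose, the matrix A A^H is normal with nonnegative eigenvalues. Their
    product is |det A|^2 and their sum, the trace, is the sum of all |a_ij|^2, hence at most N^2;
    the AM-GM inequality compares the two. *)
Lemma Hadamard_sqr (C : numClosedFieldType) N (A : 'M[C]_N) :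
  (forall i j, `|A i j| <= 1) -> `|\det A| ^+ 2 <= N%:R ^+ N.
Proof.
move=> A1; case: N => [|N] in A A1 *.
  by rewrite det_mx00 normr1 expr1n expr0.
pose conjT m n (M : 'M[C]_(m, n)) := map_mx Num.conj (M^T).
have conjTM m n p (M : 'M[C]_(m, n)) (M' : 'M[C]_(n, p)) :
    conjT _ _ (M *m M') = conjT _ _ M' *m conjT _ _ M.
  by rewrite /conjT trmx_mul map_mxM.
have conjTK m n (M : 'M[C]_(m, n)) : conjT _ _ (conjT _ _ M) = M.
  by apply/matrixP => i j; rewrite !mxE conjCK.
have trE m n (M : 'M[C]_(m, n)) :
    \tr (M *m conjT _ _ M) = \sum_i \sum_j `|M i j| ^+ 2.
  apply: eq_bigr => i _; rewrite mxE; apply: eq_bigr => j _.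
  by rewrite !mxE normCK.
pose H := A *m conjT _ _ A.
have /orthomx_spectralP HE : H \is normalmx.
  by apply/normalmxP; rewrite -/(conjT _ _ H) /H conjTM conjTK.
set P := spectralmx H in HE; set sp := spectral_diag H in HE.
have Pu : P \in unitmx := spectral_unit H.
have spE : diag_mx sp = (P *m A) *m conjT _ _ (P *m A).
  have invP : invmx P = conjT _ _ P := invmx_unitary (spectral_unitarymx H).
  rewrite conjTM -invP mulmxA -(mulmxA P A) -/H HE.
  by rewrite !mulmxA mulmxV// mul1mx -mulmxA mulmxV// mulmx1.
have sp0 i : 0 <= sp 0 i.
  have -> : sp 0 i = diag_mx sp i i by rewrite mxE eqxx.
  rewrite spE mxE sumr_ge0// => j _; rewrite !mxE -normCK.
  by rewrite exprn_ge0.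
have detH : \det H = \prod_i sp 0 i.
  by rewrite HE !det_mulmx mulrAC det_inv mulVr -?unitmxE// mul1r det_diag.
have trH : \tr H = \sum_i sp 0 i.
  by rewrite HE -mulmxA mxtrace_mulC -mulmxA mulmxV// mulmx1 mxtrace_diag.
have -> : `|\det A| ^+ 2 = \det H.
  by rewrite /H det_mulmx /conjT det_map_mx det_tr normCK.
have [] := @leif_AGM_scaled C 'I_N.+1 predT (fun i => sp 0 i).
  by move=> i _; rewrite mulrn_wge0.
rewrite -trH cardT size_enum_ord => agm _.
have : \det H *+ N.+1 ^ N.+1 <= (N.+1%:R ^+ 2) ^+ N.+1.
  move: agm; rewrite prodrMn_const card_ord -detH => /le_trans -> //.
  rewrite lerXn2r ?nnegrE//; first by rewrite trH sumr_ge0.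
    by rewrite exprn_ge0.
  have -> : N.+1%:R ^+ 2 = \sum_(i < N.+1) \sum_(j < N.+1) (1 : C).
    by rewrite !sumr_const !card_ord -[RHS]mulr_natr expr2.
  rewrite trE ler_sum// => i _; rewrite ler_sum// => j _.
  by rewrite exprn_ile1.
rewrite -[in X in X -> _](mulr_natr (\det H)) natrX expr2 exprMn.
by rewrite ler_pM2r// exprn_gt0// ltr0n.
Qed.

Lemma bin2_double n : ('C(n, 2) * 2 + n = n * n)%N.
Proof. by elim: n => // n IHn; rewrite binS bin1; lia. Qed.

(** The polynomial P with N = J+1: the Vandermonde determinant of 1, z, ..., z^(N-1) stripped of its
    power of z. *)
Definition pow_diff_prod (F : pzRingType) (N : nat) (z : F) : F :=
  \prod_(j < N) \prod_(i < j) (z ^+ (j - i) - 1).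

Lemma pow_diff_prod_le1 (C : numClosedFieldType) N (z : C) : `|z| <= 1 ->
  `|pow_diff_prod N z| ^+ 2 <= N%:R ^+ N.
Proof.
move=> z1; have [->|z0] := eqVneq z 0.
  rewrite /pow_diff_prod normr_prod big1 => [|j _]; last first.
    rewrite normr_prod big1// => i _.
    by rewrite expr0n subn_eq0 leqNgt ltn_ord sub0r normrN normr1.
  by rewrite expr1n; case: N => [|N]; rewrite ?expr0// exprn_ege1 ?ler1n.
(* The difference of the two sides is (i-j)(i-j-1)/2, so the truncated subtraction in [e] below is
   exact and the entries stay in the unit disc. *)
have bound i j : (i * j <= 'C(i, 2) + 'C(j.+1, 2))%N.
  have := bin2_double i; have := bin2_double j.+1.
  by have [/subnKC <-|/subnKC <-] := leqP i j; nia.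
(* The Vandermonde matrix of the points z^-j, with row i scaled by            *)
(* z^(i(i-1)/2) and column j by z^(j(j+1)/2): its (i,j) entry becomes         *)
(* z^((i-j)(i-j-1)/2), and the scaling cancels against the powers of z in     *)
(* prod_(i<j) (z^-j - z^-i).                                                  *)
pose e (i j : nat) := ('C(i, 2) + 'C(j.+1, 2) - i * j)%N.
pose A := \matrix_(i < N, j < N) z ^+ e i j.
pose V := @Vandermonde C N N (\row_j z^-1 ^+ j).
have AE : A = diag_mx (\row_i z ^+ 'C(i, 2)) *m V *m diag_mx (\row_j z ^+ 'C(j.+1, 2)).
  apply/matrixP => i j; rewrite mul_mx_diag mul_diag_mx !mxE -exprM [(j * i)%N]mulnC.
  rewrite mulrAC -exprD exprVn /e.
  by rewrite -[in RHS](subnK (bound i j)) exprD mulfK ?expf_neq0.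
have -> : `|pow_diff_prod N z| = `|\det A|.
  have det_diagE (f : nat -> C) : \det (diag_mx (\row_(i < N) f i)) = \prod_(i < N) f i.
    by rewrite det_diag; apply: eq_bigr => i _; rewrite mxE.
  rewrite AE !det_mulmx det_Vandermonde (det_diagE (fun i => z ^+ 'C(i, 2)))
    (det_diagE (fun i => z ^+ 'C(i.+1, 2))).
  have -> : \prod_(i < N) \prod_(j < N | (i < j)%N)
      ((\row_j z^-1 ^+ j) 0 j - (\row_j z^-1 ^+ j) 0 i) =
      (\prod_(j < N) (- z^-1 ^+ j) ^+ j) * pow_diff_prod N z.
    rewrite (exchange_big_dep predT)//= -big_split; apply: eq_bigr => j _ /=.
    have -> : (- z^-1 ^+ j) ^+ j = \prod_(i < j) (- z^-1 ^+ j).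
      by rewrite prodr_const card_ord.
    rewrite -big_split (big_ord_widen N
      (fun i => - z^-1 ^+ j * (z ^+ (j - i) - 1))) ?(ltnW (ltn_ord j))//.
    apply: eq_bigr => i ij; rewrite !mxE mulNr mulrBr mulr1 opprB; congr (_ - _).
    by rewrite -{1}(subnKC (ltnW ij)) !exprVn exprD invfM -mulrA mulVf ?mulr1 ?expf_neq0.
  move: (pow_diff_prod N z) => P.
  rewrite mulrAC mulrA -!big_split normrM normr_prod big1 ?mul1r// => i _.
  rewrite normrM normrX normrN -normrX -normrM /= -!exprM exprVn -exprD.
  have -> : ('C(i, 2) + 'C(i.+1, 2) = i * i)%N.
    by rewrite binS bin1 -bin2_double; lia.
  by rewrite mulfV ?normr1 ?expf_neq0.
by apply: Hadamard_sqr => i j; rewrite mxE normrX exprn_ile1.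
Qed.

(** P is self-reciprocal up to sign: P(z) equals z^(deg P) P(1/z) up to sign, and deg P, the sum of
    the j - i, is 'C(N+1, 3). So the bound on the unit disc applies to 1/z. *)
Lemma pow_diff_prod_ge1 (C : numClosedFieldType) N (z : C) : 1 <= `|z| ->
  `|pow_diff_prod N z| ^+ 2 <= N%:R ^+ N * `|z| ^+ (2 * 'C(N.+1, 3)).
Proof.
move=> z1; have z0 : z != 0 by rewrite -normr_gt0 (lt_le_trans ltr01).
have -> : pow_diff_prod N z =
    z ^+ 'C(N.+1, 3) * ((-1) ^+ 'C(N, 2) * pow_diff_prod N z^-1).
  have -> : 'C(N.+1, 3) = (\sum_(j < N) \sum_(i < j) (j - i))%N.
    elim: N => [|n IHn]; first by rewrite big_ord0.
    rewrite big_ord_recr binS IHn /=; congr (_ + _)%N.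
    elim: (n) => [|k IHk]; first by rewrite big_ord0.
    by rewrite big_ord_recl binS bin1 IHk addnC subn0.
  have -> : 'C(N, 2) = (\sum_(j < N) \sum_(i < j) 1)%N.
    elim: N => [|n IHn]; first by rewrite big_ord0.
    by rewrite big_ord_recr binS bin1 IHn sum1_card card_ord.
  rewrite -!prodrXr -!big_split; apply: eq_bigr => j _.
  rewrite -!prodrXr -!big_split; apply: eq_bigr => i _ /=.
  rewrite expr1 mulN1r opprB mulrBr mulr1; congr (_ - _).
  by rewrite exprVn mulfV ?expf_neq0.
rewrite normrM exprMn normrX -exprM mulnC mulrC normrM normrX normrN1 expr1n mul1r.
rewrite ler_pM2r ?exprn_gt0 ?(lt_le_trans ltr01)//.
by apply: pow_diff_prod_le1; rewrite normrV ?unitfE// invf_le1 ?(lt_le_trans ltr01).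
Qed.

(** * Complex embeddings and the norm *)

Lemma num_field_primitive (K : fieldExtType rat) :
  exists t : K, <<1; t>>%VS = fullv.
Proof.
have sepK : separable 1 {:K}.
  apply/separableP => y _; apply: pcharf0_separable => p.
  by rewrite (fmorph_pchar (in_alg K)) pchar_num.
exists (separable_generator 1 {:K}).
by rewrite -(eq_adjoin_separable_generator sepK (subvf _)).
Qed.

(** The embedding sends p(t) to p(r). It does not depend on the chosen p, since two choices differ
    by a multiple of the minimal polynomial q, which vanishes at r. *)
Lemma num_field_embedding (K : fieldExtType rat) (C : numClosedFieldType)
    (t : K) (q : {poly rat}) (r : C) :
  <<1; t>>%VS = fullv -> minPoly 1 t = map_poly (in_alg K) q ->
  root (map_poly ratr q) r -> exists s : {rmorphism K -> C}, s t = r.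
Proof.
move=> gen qE qr.
have repP x : exists p : {poly rat}, x == (map_poly (in_alg K) p).[t].
  have /Fadjoin1_polyP[p ->] : x \in <<1; t>>%VS by rewrite gen memvf.
  by exists p.
pose rep x := xchoose (repP x).
have repE x : (map_poly (in_alg K) (rep x)).[t] = x.
  by apply/esym/eqP/(xchooseP (repP x)).
pose s x := (map_poly ratr (rep x)).[r].
have sE x (p : {poly rat}) : (map_poly (in_alg K) p).[t] = x ->
    s x = (map_poly ratr p).[r].
  move=> px; apply/eqP; rewrite -subr_eq0 -hornerN -hornerD -rmorphB.
  have : q %| rep x - p.
    rewrite -(dvdp_map (in_alg K)) -qE minPoly_dvdp//; first exact: alg_polyOver.
    by rewrite /root rmorphB hornerD hornerN repE px subrr.
  by move=> /dvdpP[u ->]; rewrite rmorphM hornerM (eqP qr) mulr0.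
have sB : zmod_morphism s.
  move=> x y; rewrite (@sE _ (rep x - rep y)) ?rmorphB ?hornerD ?hornerN//.
  by rewrite !repE.
have sM : monoid_morphism s.
  split=> [|x y]; first by rewrite (@sE _ 1) ?rmorph1 ?hornerC.
  by rewrite (@sE _ (rep x * rep y)) ?rmorphM ?hornerM// !repE.
pose f : {rmorphism K -> C} := HB.pack s
  (GRing.isZmodMorphism.Build _ _ s sB) (GRing.isMonoidMorphism.Build _ _ s sM).
by exists f; rewrite /= (@sE _ 'X) ?map_polyX ?hornerX.
Qed.

(** The minimal polynomial of t is separable of degree dim K, so it has that many distinct roots.
    Distinctness is recorded at t because the values there serve as Vandermonde nodes. *)
Lemma num_field_embeddings (K : fieldExtType rat) (C : numClosedFieldType) (t : K) :
  <<1; t>>%VS = fullv ->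
  exists s : 'I_(dim K) -> {rmorphism K -> C}, injective (fun i => s i t).
Proof.
move=> gen; have /polyOver1P[q qE] := minPolyOver 1 t.
have [rs rsE] := closed_field_poly_normal (map_poly ratr q : {poly C}).
have qmon : q \is monic.
  by rewrite -(map_monic (in_alg K)) -qE monic_minPoly.
have lc : lead_coef (map_poly ratr q : {poly C}) = 1.
  by apply/eqP; rewrite -monicE map_monic.
rewrite lc scale1r in rsE.
have szr : size rs = dim K.
  apply: succn_inj; rewrite -(size_prod_XsubC rs id) -rsE size_map_poly.
  rewrite -(size_map_poly (in_alg K)) -qE size_minPoly.
  by rewrite -dimvf -gen dim_Fadjoin dimv1 muln1.
have unr : uniq rs.
  rewrite -separable_prod_XsubC -rsE separable_map -(separable_map (in_alg K)) -qE.
  apply: pcharf0_separable => p.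
  by rewrite (fmorph_pchar (in_alg K)) pchar_num.
have /fin_all_exists[s sr] (i : 'I_(dim K)) : exists s : {rmorphism K -> C}, s t = rs`_i.
  apply: num_field_embedding gen qE _.
  by rewrite rsE root_prod_XsubC mem_nth// szr.
exists s => i j; rewrite !sr => /eqP.
by rewrite nth_uniq ?szr// => /eqP/val_inj.
Qed.

(** Acts on coordinate rows from the right; its determinant is the norm of g. *)
Definition mul_mx (K : fieldExtType rat) (g : K) : 'M[rat]_(dim K) :=
  lin1_mx (fun u => v2r (r2v u * g)).

Lemma mul_mxE (K : fieldExtType rat) (g x : K) : v2r (x * g) = v2r x *m mul_mx g.
Proof.
have lin : linear (fun u => v2r (r2v u * g)).
  by move=> a u w; rewrite linearP mulrDl linearD /= -scalerAl linearZ.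
pose f : {linear 'rV[rat]_(dim K) -> 'rV_(dim K)} := HB.pack (fun u => v2r (r2v u * g))
  (GRing.isLinear.Build _ _ _ _ _ lin).
by rewrite (mul_rV_lin1 f) /= v2rK.
Qed.

Lemma mul_mx_r2v (K : fieldExtType rat) (g : K) (u : 'rV_(dim K)) :
  r2v (u *m mul_mx g) = r2v u * g.
Proof. by rewrite -{1}(r2vK u) -mul_mxE v2rK. Qed.

(** The matrix W of all embeddings of a basis diagonalises multiplication by g. It is invertible
    because it carries the coordinates of the powers of t to a Vandermonde matrix with distinct
    nodes. *)
Lemma det_mul_mx (K : fieldExtType rat) (C : numClosedFieldType) (t : K)
    (s : 'I_(dim K) -> {rmorphism K -> C}) (g : K) :
  injective (fun i => s i t) -> ratr (\det (mul_mx g)) = \prod_i s i g.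
Proof.
move=> sI.
pose W := \matrix_(i, j) s j (r2v (delta_mx 0 i)).
have sE j (u : 'rV[rat]_(dim K)) : s j (r2v u) = (map_mx ratr u *m W) 0 j.
  rewrite {1}(row_sum_delta u) !linear_sum /= rmorph_sum mxE.
  apply: eq_bigr => i _; rewrite !mxE linearZ /= -mulr_algl rmorphM; congr (_ * _).
  exact: (fmorph_eq_rat (s j \o in_alg K)).
have Wu : W \in unitmx.
  have : (map_mx ratr (\matrix_(i < dim K) v2r (t ^+ i)) *m W) \in unitmx.
    have -> : map_mx ratr (\matrix_(i < dim K) v2r (t ^+ i)) *m W =
        Vandermonde (dim K) (\row_j s j t).
      apply/matrixP => i j; rewrite !mxE -rmorphXn -[t ^+ i]v2rK sE mxE.
      by apply: eq_bigr => k _; rewrite !mxE.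
    rewrite unitmxE det_Vandermonde unitfE.
    apply/prodf_neq0 => i _; apply/prodf_neq0 => j ij; rewrite !mxE subr_eq0.
    by apply: contraTneq ij => /sI ->; rewrite ltnn.
  by rewrite unitmx_mul => /andP[].
have : map_mx ratr (mul_mx g) *m W = W *m diag_mx (\row_j s j g).
  apply/row_matrixP => i; apply/rowP => j.
  transitivity (s j (r2v (delta_mx 0 i) * g)); last first.
    by rewrite rmorphM mul_mx_diag !mxE.
  by rewrite row_mul -map_row -sE -mul_mx_r2v -rowE.
move=> /(congr1 determinant); rewrite !det_mulmx det_map_mx det_diag [RHS]mulrC.
move=> /(mulIf _) -> //; last by rewrite -unitfE -unitmxE.
by apply: eq_bigr => i _; rewrite mxE.
Qed.

(** * Index of a sublattice *)

(** In Smith normal form the quotient by the row lattice of B is a product of cyclic groups of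
    orders |s_i|, and |det B| is the product of these orders. The residues modulo the s_i therefore
    tell incongruent rows apart. *)
Lemma size_incongruent_rows d (B : 'M[int]_d) (S : seq 'rV[int]_d) :
  \det B != 0 -> uniq S ->
  {in S &, forall c c', (exists e, c - c' = e *m B) -> c = c'} ->
  (size S <= `|\det B|)%N.
Proof.
move=> detB uS inc; have [U Uu [V Vu [s' _ BE]]] := int_Smith_normal_form B.
pose s (i : nat) : int := s'`_i.
have DE : \matrix_(i < d, j < d) (s'`_i *+ (i == j :> nat)) = diag_mx (\row_j s j).
  by apply/matrixP => i j; rewrite !mxE -val_eqE; case: eqP => //= ->.
rewrite DE in BE.
have detE : `|\det B|%N = (\prod_(i < d) `|s i|)%N.
  rewrite BE !det_mulmx det_diag !abszM.
  have -> : `|\det U|%N = 1%N by move: Uu; rewrite unitmxE => /orP[] /eqP ->.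
  have -> : `|\det V|%N = 1%N by move: Vu; rewrite unitmxE => /orP[] /eqP ->.
  rewrite muln1 mul1n (big_morph absz abszM (erefl : absz 1 = 1%N)).
  by apply: eq_bigr => i _; rewrite mxE.
have s0 (i : 'I_d) : s i != 0.
  apply: contra_neq detB => si0; apply/eqP; rewrite -absz_eq0 detE.
  by rewrite (bigD1 i)//= si0 mul0n.
have keyP (c : 'rV[int]_d) (i : 'I_d) : (`|((c *m invmx V) ord0 i %% s i)%Z| < `|s i|)%N.
  by rewrite -ltz_nat gez0_abs ?modz_ge0// ltz_mod.
pose key c : {dffun forall i : 'I_d, 'I_(`|s i|)} := [ffun i => Ordinal (keyP c i)].
have keyI : {in S &, injective key}.
  move=> c c' cS cS' /ffunP kE; apply: inc => //.
  have dv (i : 'I_d) : (s i %| ((c - c') *m invmx V) ord0 i)%Z.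
    rewrite mulmxBl mxE [X in _ + X]mxE -eqz_mod_dvd.
    have /(congr1 val) := kE i; rewrite !ffunE /= => E; apply/eqP.
    by rewrite -[LHS]gez0_abs ?modz_ge0// E gez0_abs ?modz_ge0.
  exists ((\row_i (((c - c') *m invmx V) ord0 i %/ s i)%Z) *m invmx U).
  rewrite BE !mulmxA mulmxKV// -{1}[c - c'](mulmxKV Vu); apply: (congr1 (mulmx^~ V)).
  apply/rowP => i; rewrite mul_mx_diag [RHS]mxE [X in _ = X * _]mxE.
  by rewrite [X in _ = _ * X]mxE divzK ?dv.
rewrite detE; have -> : (\prod_(i < d) `|s i| = #|{dffun forall i : 'I_d, 'I_(`|s i|)}|)%N.
  rewrite card_dep_ffun foldrE big_map big_enum /=.
  by apply: eq_bigr => i _; rewrite card_ord.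
by rewrite -(size_map key) -(card_uniqP _) ?max_card// map_inj_in_uniq.
Qed.

Definition Zspan (V : zmodType) (L : seq V) (x : V) : Prop :=
  exists c : nat -> int, x = \sum_(i < size L) L`_i *~ c i.

Lemma Zspan_mem (V : zmodType) (L : seq V) : {in L, forall x, Zspan L x}.
Proof.
move=> x xL; exists (fun i => (i == index x L)%:Z).
have xi : (index x L < size L)%N by rewrite index_mem.
rewrite (bigD1 (Ordinal xi))//= eqxx nth_index// mulr1z big1 ?addr0// => i ix.
have /negbTE -> : i != index x L :> nat := ix.
  by rewrite mulr0z.
Qed.

Lemma Zspan0 (V : zmodType) (L : seq V) : Zspan L 0.
Proof. by exists (fun=> 0); rewrite big1// => i _; rewrite mulr0z. Qed.

Lemma ZspanD (V : zmodType) (L : seq V) x y : Zspan L x -> Zspan L y -> Zspan L (x + y).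
Proof.
move=> [a ->] [b ->]; exists (fun i => a i + b i).
by rewrite -big_split; apply: eq_bigr => i _; rewrite mulrzDr.
Qed.

Lemma ZspanMz (V : zmodType) (L : seq V) x n : Zspan L x -> Zspan L (x *~ n).
Proof.
move=> [a ->]; exists (fun i => a i * n).
by rewrite mulrz_suml; apply: eq_bigr => i _; rewrite mulrzA.
Qed.

Lemma Zspan_sum (V : zmodType) (L : seq V) (I : Type) (r : seq I) (Q : pred I) (F : I -> V) :
  (forall i, Q i -> Zspan L (F i)) -> Zspan L (\sum_(i <- r | Q i) F i).
Proof. by move=> LF; apply: (big_ind (Zspan L)); [exact: Zspan0|exact: ZspanD|]. Qed.

Lemma Zspan_sub (V : zmodType) (L : seq V) (P : V -> Prop) x : P 0 ->
  (forall x y, P x -> P y -> P (x - y)) -> {in L, forall y, P y} -> Zspan L x -> P x.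
Proof.
move=> P0 PB PL [c ->].
have PN y : P y -> P (- y) by rewrite -sub0r => ?; exact: PB.
have PD y z : P y -> P z -> P (y + z) by move=> ? ?; rewrite -[z]opprK; apply: PB; auto.
have Pn y n : P y -> P (y *+ n) by move=> Py; elim: n => // n; rewrite mulrS; exact: PD.
apply: (big_ind P) => // i _.
have := PL L`_i (mem_nth _ (ltn_ord i)).
by case: (c i) => n Py; rewrite ?NegzE ?mulrNz; [|apply: PN]; exact: Pn.
Qed.

Lemma rat_mx_common_denominator n d (A : 'M[rat]_(n, d)) :
  exists2 D : int, D != 0 & exists A' : 'M[int]_(n, d), A = D%:~R^-1 *: map_mx intr A'.
Proof.
pose D := \prod_(p : 'I_n * 'I_d) denq (A p.1 p.2).
have D0 : D != 0 by apply/prodf_neq0 => p _; rewrite denq_eq0.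
exists D => //; exists (\matrix_(i, j) numq (D%:~R * A i j)).
apply/matrixP => i j; rewrite !mxE numqK ?mulKf ?intr_eq0//.
rewrite /D (bigD1 (i, j))//= rmorphM mulrAC [_ * A i j]mulrC -numqE -intrM.
exact: intr_int.
Qed.

(** A finitely generated lattice of full rank in Q^d is free of rank d. After clearing denominators,
    the Smith form replaces the generators by d rows through a unimodular change; fullness makes
    these rows independent. *)
Lemma Zspan_basis d (L : seq 'rV[rat]_d) :
  (forall x, exists2 D : nat, (0 < D)%N & Zspan L (x *+ D)) ->
  exists2 E : 'M[rat]_d, E \in unitmx &
    forall x, Zspan L x <-> exists c : 'rV[int]_d, x = map_mx intr c *m E.
Proof.
move=> full; pose n := size L; pose A := \matrix_(i < n) L`_i.
have spanE x : Zspan L x <-> exists c : 'rV[int]_n, x = map_mx intr c *m A.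
  split=> [[c ->]|[c ->]].
    exists (\row_i c i); rewrite mulmx_sum_row; apply: eq_bigr => i _.
    by rewrite rowK !mxE scaler_int.
  pose c' i := if insub i is Some j then c 0 j else 0.
  exists c'; rewrite mulmx_sum_row; apply: eq_bigr => i _.
  by rewrite rowK !mxE scaler_int /c' valK.
have Afull : row_full A.
  apply/row_fullP.
  have /fin_all_exists[B BE] (i : 'I_d) : exists b : 'rV_n, delta_mx 0 i = b *m A.
    have [D D0 /spanE[c cE]] := full (delta_mx 0 i).
    exists (D%:R^-1 *: map_mx intr c); rewrite -scalemxAl -cE -scaler_nat scalerA.
    by rewrite mulVf ?scale1r// pnatr_eq0 -lt0n.
  exists (\matrix_i B i); apply/row_matrixP => i.
  by rewrite row_mul rowK -BE row1.
have le_dn : (d <= n)%N.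
  by rewrite -(eqP Afull) rank_leq_row.
have [D D0 [A' AE]] := rat_mx_common_denominator A.
have [U Uu [V Vu [s _ A'E]]] := int_Smith_normal_form A'.
have DE : \matrix_(i < n, j < d) (s`_i *+ (i == j :> nat)) =
    pid_mx d *m diag_mx (\row_j s`_j).
  apply/matrixP => i j; rewrite mul_mx_diag !mxE.
  have [->|] := eqVneq (i : nat) j; first by rewrite ltn_ord mul1r.
  by rewrite mul0r.
pose E := D%:~R^-1 *: map_mx intr (diag_mx (\row_j s`_j) *m V) : 'M[rat]_d.
have AE' : A = map_mx intr (U *m pid_mx d) *m E.
  by rewrite AE A'E DE -!mulmxA mulmxA map_mxM scalemxAr.
exists E.
  rewrite -row_full_unit -sub1mx.
  apply: submx_trans (submxMl (map_mx intr (U *m pid_mx d)) E).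
  by rewrite -AE' sub1mx.
move=> x; split=> [/spanE[c ->]|[c ->]].
  by exists (c *m (U *m pid_mx d)); rewrite AE' mulmxA -map_mxM.
apply/spanE; exists (c *m pid_mx d *m invmx U).
rewrite AE' mulmxA -map_mxM !mulmxA mulmxKV// -[c *m _ *m _]mulmxA.
by rewrite pid_mx_id// pid_mx_1 mulmx1.
Qed.

Lemma Zspan_map (U V : zmodType) (f : {additive U -> V}) (L : seq U) x :
  Zspan L x -> Zspan (map f L) (f x).
Proof.
move=> [c ->]; exists c; rewrite size_map raddf_sum; apply: eq_bigr => i _.
by rewrite (nth_map 0)// raddfMz.
Qed.

Lemma map_section (S : eqType) (U : eqType) (f : U -> S) (T : seq S) :
  {in T, forall t, exists u, f u = t} -> exists L, map f L = T.
Proof.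
elim: T => [|t T IHT] fT; first by exists [::].
have [|L LE] := IHT; first by move=> u uT; apply: fT; rewrite inE uT orbT.
by have [|u uE] := fT t; [rewrite inE eqxx|exists (u :: L); rewrite /= uE LE].
Qed.

Lemma det_mul_mx_neq0 (K : fieldExtType rat) (g : K) : g != 0 -> \det (mul_mx g) != 0.
Proof.
move=> g0; apply/negP => /det0P[v v0 vg].
move: v0; rewrite -(r2vK v) -{1}(mulfK g0 (r2v v)) -mul_mx_r2v vg.
by rewrite linear0 mul0r linear0 eqxx.
Qed.

(* T and multiples of a basis of K generate under g a lattice L of full rank  *)
(* with L g in L in P; the elements of T are incongruent modulo L g, and      *)
(* L g has index |det g| in L.                                                *)
Lemma size_incongruent (K : fieldExtType rat) (g : K) (p : {poly int})
    (P : K -> Prop) (T : seq K) :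
  g != 0 -> p \is monic -> root (map_poly intr p) g ->
  P 0 -> (forall x y, P x -> P y -> P (x - y)) -> (forall x, P x -> P (x * g)) ->
  (forall x, exists2 D : nat, (0 < D)%N & P (x *+ D)) ->
  uniq T -> {in T, forall t, P t} ->
  {in T &, forall x y, (exists2 z, P z & x - y = z * g) -> x = y} ->
  (size T)%:R <= `|\det (mul_mx g)|.
Proof.
move=> g0 pmon proot P0 PB Pg Pfull uT TP inc.
have /fin_all_exists2[D D0 DP] (i : 'I_(dim K)) := Pfull (r2v (delta_mx 0 i)).
pose W := T ++ [seq r2v (delta_mx 0 i) *+ D i | i : 'I_(dim K)].
pose n := (size p).-1.
have szp : size p = n.+1.
  by rewrite prednK// size_poly_gt0 monic_neq0.
have gn : g ^+ n = - \sum_(j < n) g ^+ j *~ p`_j.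
  apply/eqP; rewrite -addr_eq0; move: proot.
  rewrite /root horner_coef size_map_poly_id0 ?(eqP pmon) ?rmorph1 ?oner_eq0//.
  rewrite szp big_ord_recr/= addrC coef_map.
  have -> : p`_n = 1 by rewrite -(eqP pmon) lead_coefE szp.
  rewrite mul1r; congr (_ + _ == 0); apply: eq_bigr => j _.
  by rewrite coef_map mulrC mulrzr.
have n0 : (0 < n)%N.
  by case: (n) gn => // /eqP; rewrite expr0 big_ord0 oppr0 oner_eq0.
(* Powers below the degree of p suffice: by [gn] the next one is an integral combination of them, so
   the span is stable under g. *)
pose L := [seq w * g ^+ j | w <- W, j <- iota 0 n].
have LW w : w \in W -> Zspan L w.
  move=> wW; rewrite -[w]mulr1 -(expr0 g); apply: Zspan_mem.
  by apply/allpairsP; exists (w, 0%N); rewrite mem_iota.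
have LP : {in L, forall y, P y}.
  move=> _ /allpairsP[[w j]] /= [wW _ ->].
  have Pw : P w by move: wW; rewrite mem_cat => /orP[/TP//|/mapP[i _ ->]].
  by elim: j => [|j IHj]; rewrite ?mulr1// exprSr mulrA; apply: Pg.
have Lg y : Zspan L y -> Zspan L (y * g).
  move=> [c ->]; rewrite mulr_suml; apply: Zspan_sum => i _.
  rewrite mulrzAl; apply: ZspanMz.
  have /allpairsP[[w j] /= [wW jn ->]] := mem_nth 0 (ltn_ord i).
  rewrite mem_iota /= add0n in jn; rewrite -mulrA -exprSr.
  have [j1n|] := ltnP j.+1 n.
    by apply: Zspan_mem; apply/allpairsP; exists (w, j.+1); rewrite mem_iota.
  rewrite leq_eqVlt ltnNge jn orbF => /eqP <-.
  rewrite gn mulrN mulr_sumr -mulrN1z; apply: ZspanMz; apply: Zspan_sum => k _.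
  rewrite mulrzAr; apply: ZspanMz; apply: Zspan_mem.
  by apply/allpairsP; exists (w, k : nat); rewrite mem_iota /=.
have [|E Eu EP] := @Zspan_basis _ (map v2r L).
  move=> x; exists (\prod_i (D i * `|denq (x ord0 i)|))%N.
    by rewrite prodn_gt0// => i; rewrite muln_gt0 D0 absz_gt0 denq_eq0.
  rewrite -[x in x *+ _]r2vK -raddfMn; apply: (Zspan_map v2r).
  rewrite {1}(row_sum_delta x) linear_sum /= -sumrMnl; apply: Zspan_sum => i _.
  rewrite (bigD1 i)//=; set k := (\prod_(_ < _ | _) _)%N.
  rewrite [X in Zspan L X](_ : _ =
      r2v (delta_mx 0 i) *+ D i *~ (numq (x 0 i) * k%:Z)); last first.
    rewrite linearZ -scaler_nat -scaler_int -scaler_nat !scalerA; congr (_ *: _).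
    rewrite !natrM intrM numqE -[in RHS]absz_denq -!pmulrn /=; ring.
  apply/ZspanMz/LW; rewrite mem_cat orbC; apply/orP; left.
  by apply/mapP; exists i; rewrite ?mem_enum.
have EK x : Zspan L x <-> exists c : 'rV[int]_(dim K), x = r2v (map_mx intr c *m E).
  split=> [/(Zspan_map v2r)/EP[c xE]|[c xE]].
    by exists c; rewrite -xE /= v2rK.
  have /EP/(Zspan_map r2v) : exists c : 'rV[int]_(dim K), v2r x = map_mx intr c *m E.
    by exists c; rewrite xE r2vK.
  by rewrite /= v2rK -map_comp map_id_in// => y _; rewrite /= v2rK.
have /fin_all_exists[b bE] (i : 'I_(dim K)) :
    exists b : 'rV[int]_(dim K), row i E *m mul_mx g = map_mx intr b *m E.
  have /Lg/EK[b bE] : Zspan L (r2v (row i E)).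
    apply/EK; exists (delta_mx 0 i); congr r2v.
    by rewrite map_delta_mx rowE.
  by exists b; apply: r2v_inj; rewrite -bE mul_mx_r2v.
(* In the basis E of the lattice, multiplication by g is the integer matrix B; the change of basis
   preserves the determinant. *)
pose B := \matrix_i b i.
have detB : \det (mul_mx g) = (\det B)%:~R.
  apply: (@mulfI _ (\det E)); first by rewrite -unitfE -unitmxE.
  rewrite -det_mulmx mulrC -det_map_mx -det_mulmx; congr (\det _).
  by apply/row_matrixP => i; rewrite !row_mul bE -map_row rowK.
have B0 : \det B != 0 by rewrite -(intr_eq0 rat) -detB det_mul_mx_neq0.
pose f (c : 'rV[int]_(dim K)) : K := r2v (map_mx intr c *m E).
have fI : injective f.
  move=> c c' /r2v_inj/(can_inj (mulmxK Eu))/rowP cc.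
  by apply/rowP => i; have := cc i; rewrite !mxE => /intr_inj.
have [|S SE] := @map_section _ _ f T.
  by move=> t tT; have /LW/EK[c ->] : t \in W; [rewrite mem_cat tT|exists c].
rewrite detB -intr_norm -SE size_map pmulrn ler_int -abszE lez_nat.
apply: size_incongruent_rows => //; first by rewrite -(map_inj_uniq fI) SE.
move=> c c' cS cS' [e ce]; apply: fI; apply: inc; rewrite -?SE ?map_f//.
exists (f e).
  by apply: Zspan_sub P0 PB LP _; apply/EK; exists e.
rewrite -mul_mx_r2v -linearB -mulmxBl -map_mxB ce map_mxM -!mulmxA; congr (r2v (_ *m _)).
by apply/row_matrixP => i; rewrite !row_mul bE -map_row rowK.
Qed.

(** * Weak approximation *)

Lemma expr_gt_eventually (R : realType) (a M : R) : 1 < a ->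
  exists N, forall r, (N <= r)%N -> M < a ^+ r.
Proof.
move=> a1; have bern r : 1 + (a - 1) *+ r <= a ^+ r.
  elim: r => [|r IHr]; first by rewrite addr0.
  have ar : 1 <= a ^+ r by rewrite exprn_ege1// ltW.
  by rewrite exprS mulrS; nra.
exists (Num.truncn (`|M| / (a - 1))).+1 => r Nr.
apply: lt_le_trans (bern r).
have a10 : 0 < a - 1 by rewrite subr_gt0.
apply: (@le_lt_trans _ _ `|M|); first exact: ler_norm.
apply: (@lt_trans _ _ ((a - 1) *+ r)); last by rewrite ltrDr.
rewrite -mulr_natr mulrC -ltr_pdivrMr//.
apply: lt_le_trans (_ : (Num.truncn (`|M| / (a - 1))).+1%:R <= _); last by rewrite ler_nat.
exact: truncnS_gt.
Qed.

Lemma expr_lt_eventually (R : realType) (a e : R) : 0 <= a -> a < 1 -> 0 < e ->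
  exists N, forall r, (N <= r)%N -> a ^+ r < e.
Proof.
rewrite le_eqVlt => /orP[/eqP <- _ e0|a0 a1 e0].
  by exists 1%N => -[|r]// _; rewrite expr0n.
have [N NP] := @expr_gt_eventually R a^-1 e^-1 (ltac:(by rewrite invf_gt1)).
by exists N => r /NP; rewrite exprVn ltf_pV2 ?posrE ?exprn_gt0.
Qed.

Lemma eventually_seq (T : eqType) (S : seq T) (Q : T -> nat -> Prop) :
  {in S, forall w, exists N, forall r, (N <= r)%N -> Q w r} ->
  exists N, forall r, (N <= r)%N -> {in S, forall w, Q w r}.
Proof.
elim: S => [|w S IHS] QS; first by exists 0%N.
have [|N NP] := IHS; first by move=> u uS; apply: QS; rewrite inE uS orbT.
have [|M MP] := QS w; first by rewrite inE eqxx.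
exists (maxn N M) => r; rewrite geq_max => /andP[Nr Mr] u.
by rewrite inE => /orP[/eqP ->|]; [exact: MP|exact: NP].
Qed.

Lemma ln_exprz (R : realType) (a : R) (n : int) : 0 < a -> ln (a ^ n) = ln a *~ n.
Proof.
move=> a0; case: n => n; first by rewrite -exprnP lnXn.
by rewrite NegzE -exprnN lnV ?posrE ?exprn_gt0// lnXn// mulrNz.
Qed.

Section AbsvalPowers.
Context {R : realType} {K : fieldType}.
Implicit Types v w : absval R K.

Lemma absvalX v x n : v (x ^+ n) = v x ^+ n.
Proof. by elim: n => [|n IHn]; rewrite ?absval1// !exprS absvalM IHn. Qed.

Lemma absval_exprz v x (n : int) : v (x ^ n) = v x ^ n.
Proof. by case: n => n; rewrite ?NegzE -?exprnN -?exprnP ?absvalV ?absvalX. Qed.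

Lemma absval_sum v (I : Type) (r : seq I) (Q : pred I) (F : I -> K) :
  v (\sum_(i <- r | Q i) F i) <= \sum_(i <- r | Q i) v (F i).
Proof.
elim/big_rec2: _ => [|i a b _ ab]; first by rewrite absval0.
by rewrite (le_trans (ler_absvalD _ _ _))// lerD2l.
Qed.

Lemma absval_prod v (I : Type) (r : seq I) (Q : pred I) (F : I -> K) :
  v (\prod_(i <- r | Q i) F i) = \prod_(i <- r | Q i) v (F i).
Proof. by apply: (big_morph v (absvalM v)); exact: absval1. Qed.

Lemma absval_ext v w : v =1 w -> v = w.
Proof.
case: v w => [f f0 f1 f2 f3] [g g0 g1 g2 g3] /= /funext fg; subst g.
by congr Absval; exact: Prop_irrelevance.
Qed.

(** Inclusion of open unit balls makes v and w equivalent, that is, powers of each other; the common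
    value at t fixes the exponent to 1. *)
Lemma absval_le_of_lt1 v w t : 0 < v t -> v t < 1 -> v t = w t ->
  (forall x, v x < 1 -> w x < 1) -> forall x, w x <= v x.
Proof.
move=> t0 t1 vwt vw x; have [->|x0] := eqVneq x 0; first by rewrite !absval0.
have vx0 : 0 < v x by rewrite absval_gt0.
have wx0 : 0 < w x by rewrite absval_gt0.
have tn0 : t != 0 by rewrite -(absval_gt0 v).
rewrite leNgt; apply/negP => vx_wx.
have lnt : ln (v t) < 0 by rewrite ln_lt0// t0.
have lnE (u : absval R K) (b : nat) (a : int) :
    ln (u (x ^+ b * t ^ a)) = ln (u x) * b%:R + ln (u t) * a%:~R.
  have ux0 : 0 < u x by rewrite absval_gt0.
  have ut0 : 0 < u t by rewrite absval_gt0.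
  rewrite absvalM absvalX absval_exprz lnM ?posrE ?exprn_gt0 ?exprz_gt0//.
  by rewrite lnXn// ln_exprz// mulr_natr mulrzr.
have lnlt : ln (v x) < ln (w x) by rewrite ltr_ln.
have lnlt0 (u : absval R K) y : y != 0 -> (ln (u y) < 0) = (u y < 1).
  by move=> y0; rewrite -{1}(ln1 R) ltr_ln ?posrE ?absval_gt0.
(* If v x < w x, then v (x^b t^a) < 1 <= w (x^b t^a) for suitable b and a.     *)
set al := ln (v x) in lnE lnlt; set be := ln (w x) in lnlt.
(* With b this large, the interval between b [al] and b [be] is longer than -ln (v t), so it
   contains a multiple a of that number. *)
pose b := (Num.truncn (- ln (v t) / (be - al))).+1.
pose a := Num.floor (be * b%:R / - ln (v t)).
have ba : - ln (v t) < b%:R * (be - al).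
  by rewrite -ltr_pdivrMr ?subr_gt0// truncnS_gt.
have a1 : a%:~R * - ln (v t) <= be * b%:R.
  by rewrite -ler_pdivlMr ?oppr_gt0// floor_le.
have a2 : be * b%:R < (a + 1)%:~R * - ln (v t).
  by rewrite -ltr_pdivrMr ?oppr_gt0// floorD1_gt.
have xt0 : x ^+ b * t ^ a != 0 by rewrite mulf_neq0 ?expf_neq0// expfz_neq0.
have := vw (x ^+ b * t ^ a); rewrite -!lnlt0// !lnE -vwt -/al -/be.
move: a2; rewrite intrD => a2 H.
have : be * b%:R + ln (v t) * a%:~R < 0 by apply: H; nra.
by nra.
Qed.

End AbsvalPowers.

Section Places.
Context {R : realType} {K : fieldExtType rat}.
Implicit Types v w : absval R K.

Definition arch_place v := forall q, absval_rat v q = ratr `|q|.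
Definition padic_place p v := prime p /\ forall q, absval_rat v q = padic_abs p q.

Lemma placesP v : places v <-> arch_place v \/ exists p, padic_place p v.
Proof.
split=> [[va|[p pp vp]]|[va|[p [pp vp]]]]; by [left|right; exists p].
Qed.

Lemma absval_ratE v q : absval_rat v q = v (in_alg K q).
Proof. by []. Qed.

Lemma arch_nat v n : arch_place v -> v n%:R = n%:R.
Proof.
by move=> va; rewrite -(rmorph_nat (in_alg K)) -absval_ratE va normr_nat ratr_nat.
Qed.

Lemma padic_nat p v n : padic_place p v -> (0 < n)%N ->
  v n%:R = (p ^ logn p n)%:R^-1.
Proof.
move=> [pp vp] n0; rewrite -(rmorph_nat (in_alg K)) -absval_ratE vp /padic_abs.
rewrite pnatr_eq0 eqn0Ngt n0 /= (pmulrn (1 : rat)) numq_int denq_int /= logn1 sub0r.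
by rewrite -exprnN natrX.
Qed.

Lemma padic_nat_le1 p v n : padic_place p v -> v n%:R <= 1.
Proof.
move=> vp; case: n => [|n]; first by rewrite absval0.
rewrite (padic_nat vp)// invf_le1 ?ltr0n ?expn_gt0 ?ler1n ?expn_gt0 ?prime_gt0//; exact: vp.1.
Qed.

Lemma padic_int_le1 p v (z : int) : padic_place p v -> v z%:~R <= 1.
Proof.
move=> vp; case: z => n; first exact: padic_nat_le1 vp.
by rewrite NegzE mulrNz absvalN (padic_nat_le1 _ vp).
Qed.

Lemma padic_int_ge p v (z : int) : padic_place p v -> z != 0 ->
  `|z|%:~R^-1 <= v z%:~R.
Proof.
move=> vp; wlog: z / 0 <= z => [H|].
  have [/H//|z0] := leP 0 z; move=> zn0.
  by rewrite -absvalN -mulrNz -normrN; apply: H; rewrite ?oppr_ge0 ?oppr_eq0// ltW.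
case: z => // n _ n0; rewrite ger0_norm// -!pmulrn (padic_nat vp) ?lt0n//.
have n1 : (0 < n)%N by rewrite lt0n.
rewrite lef_pV2 ?posrE ?ltr0n ?expn_gt0 ?(prime_gt0 vp.1)//.
by rewrite ler_nat dvdn_leq// pfactor_dvdnn.
Qed.

Lemma padic_prime p v : padic_place p v -> v p%:R = p%:R^-1.
Proof.
by move=> vp; rewrite (padic_nat vp) ?prime_gt0 ?logn_prime ?eqxx ?expn1//; exact: vp.1.
Qed.

(** Uses the normalisation on Q: t is 1/2 for archimedean v and p for p-adic v. The inclusion of
    unit balls forces w to restrict to the same absolute value of Q. *)
Lemma place_common_value v w : places v -> places w ->
  (forall x, v x < 1 -> w x < 1) ->
  exists t, [/\ 0 < v t, v t < 1 & v t = w t].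
Proof.
move=> /placesP[va|[p vp]] /placesP pw vw.
- have v2 : v 2%:R^-1 = 2^-1 by rewrite absvalV arch_nat.
  exists 2%:R^-1; rewrite v2; split; [lra|lra|].
  case: pw => [wa|[p wp]]; first by rewrite absvalV arch_nat.
  have := vw 2%:R^-1; rewrite v2 => /(_ _) H.
  have /H : (2^-1 : R) < 1 by lra.
  rewrite absvalV ltNge invf_ge1 ?(padic_nat_le1 2 wp)// absval_gt0.
  by rewrite -(rmorph_nat (in_alg K)) fmorph_eq0 pnatr_eq0.
- have p1 : (1 < p)%N := prime_gt1 vp.1.
  have vpE := padic_prime vp.
  have vp1 : v p%:R < 1 by rewrite vpE invf_lt1 ?ltr0n ?ltr1n// ltnW.
  exists p%:R; split=> //; first by rewrite vpE invr_gt0 ltr0n ltnW.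
  case: pw (vw _ vp1) => [wa|[q wq]].
    by rewrite arch_nat// ltNge ler1n (ltnW p1).
  rewrite (padic_nat wq) ?(ltnW p1)// => wq1.
  have qp : q = p.
    apply/eqP; rewrite -dvdn_prime2 ?(vp.1) ?(wq.1)//; apply: contraLR wq1 => qp.
    by rewrite lognE (negbTE qp) !andbF expn0 invr1 ltxx.
  by rewrite vpE -qp logn_prime ?(wq.1)// eqxx expn1.
Qed.

Lemma place_separation v w : places v -> places w -> v <> w ->
  exists2 x, v x < 1 & 1 <= w x.
Proof.
move=> pv pw vw; apply: contrapT => H; apply: vw.
have lt1 x : v x < 1 -> w x < 1.
  by move=> vx; rewrite ltNge; apply/negP => wx; apply: H; exists x.
have [t [t0 t1 vwt]] := place_common_value pv pw lt1.
have le x := absval_le_of_lt1 t0 t1 vwt lt1 x.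
apply: absval_ext => x; apply/eqP; rewrite eq_le le andbT.
have [->|x0] := eqVneq x 0; first by rewrite !absval0.
by have := le x^-1; rewrite !absvalV lef_pV2 ?posrE ?absval_gt0.
Qed.

(** The sequence y^r/(1 + y^r) tends to 1 where y is large and, by the next lemma, to 0 where y is
    small. Weak approximation consists in finding y with the right sizes. *)
Lemma absval_big_limit v (y : K) (e : R) : 1 < v y -> 0 < e ->
  exists N, forall r, (N <= r)%N -> v (y ^+ r / (1 + y ^+ r) - 1) < e.
Proof.
move=> vy e0; have [N NP] := expr_gt_eventually (1 + e^-1) vy.
exists N => r /NP vr.
have e1 : 0 < e^-1 by rewrite invr_gt0.
have big : e^-1 < v (1 + y ^+ r).
  have := ler_absvalB v (- y ^+ r) 1; rewrite absvalN absval1 absvalX => H.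
  by rewrite -absvalN opprD addrC (lt_le_trans _ H)// ltrBrDl.
have n0 : 1 + y ^+ r != 0 by rewrite -(absval_gt0 v) (lt_trans e1).
have -> : y ^+ r / (1 + y ^+ r) - 1 = - (1 + y ^+ r)^-1 by field.
by rewrite absvalN absvalV -(invrK e) ltf_pV2 ?posrE// (lt_trans e1).
Qed.

Lemma absval_small_limit v (y : K) (e : R) : v y < 1 -> 0 < e ->
  exists N, forall r, (N <= r)%N -> v (y ^+ r / (1 + y ^+ r)) < e.
Proof.
move=> vy e0; have e20 : 0 < Num.min (2^-1) (e / 2) by rewrite lt_min; apply/andP; split; lra.
have [N NP] := expr_lt_eventually (absval_ge0 v y) vy e20.
exists N => r /NP; rewrite lt_min => /andP[r1 r2].
have big : 2^-1 <= v (1 + y ^+ r).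
  have := ler_absvalB v 1 (- y ^+ r); rewrite absvalN absval1 absvalX opprK => H.
  by apply: le_trans H; lra.
rewrite absvalM absvalV absvalX ltr_pdivrMr; last by apply: lt_le_trans big; lra.
by nra.
Qed.

(** The Artin-Whaples induction. Let y work for S, and let z = b/a be large at v and small at the
    new place w. If |y|_w <= 1, a high power of y times z works. Otherwise y^r/(1 + y^r) times z
    does: the first factor tends to 1 at v and w and to 0 on S. *)
Lemma place_dominating v (S : seq (absval R K)) : places v ->
  {in S, forall w, places w} -> v \notin S ->
  exists2 y, 1 < v y & {in S, forall w : absval R K, w y < 1}.
Proof.
move=> pv; elim: S => [|w S IHS] pS.
  have [t [t0 t1 _]] := place_common_value pv pv (fun _ => id).
  by exists t^-1; rewrite ?absvalV ?invf_gt1.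
rewrite inE negb_or => /andP[vw vS].
have pw : places w by apply: pS; rewrite inE eqxx.
have [|y vy Sy] := IHS _ vS; first by move=> u uS; apply: pS; rewrite inE uS orbT.
have [a va wa] := place_separation pv pw (elimN eqP vw).
have [b wb vb] := place_separation pw pv (fun E => elimN eqP vw (esym E)).
have a0 : a != 0 by rewrite -(absval_gt0 w) (lt_le_trans ltr01).
pose z := b / a.
have vz : 1 < v z.
  by rewrite /z absvalM absvalV ltr_pdivlMr ?absval_gt0// mul1r (lt_le_trans va).
have wz : w z < 1.
  by rewrite /z absvalM absvalV ltr_pdivrMr ?absval_gt0// mul1r (lt_le_trans wb).
have z1 (u : absval R K) : exists2 e : R, 0 < e & forall c, c < e -> c * u z < 1.
  have uz := absval_ge0 u z.
  have u1 : 0 < u z + 1 by apply: ltr_wpDl.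
  exists (u z + 1)^-1; first by rewrite invr_gt0.
  move=> c ce.
  move: ce; rewrite -[_^-1]mul1r ltr_pdivlMr// => ce.
  have [c0|c0] := leP c 0; first by rewrite (le_lt_trans (mulr_le0_ge0 c0 uz)).
  by nra.
have [wy|wy] := leP (w y) 1.
  have [N NP] : exists N, forall r, (N <= r)%N -> {in S, forall u : absval R K, u (y ^+ r * z) < 1}.
    apply: eventually_seq => u uS; have [e e0 ez] := z1 u.
    have [N NP] := expr_lt_eventually (absval_ge0 u y) (Sy u uS) e0.
    by exists N => r /NP/ez; rewrite absvalM absvalX.
  exists (y ^+ N * z) => [|u].
    rewrite [v _]absvalM absvalX; apply: lt_le_trans vz _.
    by apply: ler_peMl; rewrite ?absval_ge0// exprn_ege1// ltW.
  rewrite inE => /orP[/eqP ->|]; last exact: NP.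
  rewrite [w _]absvalM absvalX; apply: le_lt_trans wz.
  by apply: ler_piMl; rewrite ?absval_ge0// exprn_ile1 ?absval_ge0.
pose f r := y ^+ r / (1 + y ^+ r) * z.
have [N1 N1P] : exists N, forall r, (N <= r)%N -> {in S, forall u : absval R K, u (f r) < 1}.
  apply: eventually_seq => u uS; have [e e0 ez] := z1 u.
  have [N NP] := absval_small_limit (Sy u uS) e0.
  by exists N => r /NP/ez; rewrite /f [u (_ * z)]absvalM.
have [N2 N2P] : exists N, forall r, (N <= r)%N -> 1 < v (f r).
  pose e := 1 - (v z)^-1.
  have vz0 : 0 < v z by rewrite (lt_trans ltr01).
  have e0 : 0 < e by rewrite subr_gt0 invf_lt1.
  have [N NP] := absval_big_limit vy e0; exists N => r /NP.
  set g := y ^+ r / _ => ge.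
  have : (v z)^-1 < v g.
    have := ler_absvalB v 1 g; rewrite absval1 absvalBC => H.
    by move: ge; rewrite /e; lra.
  by rewrite /f absvalM -[_^-1]mul1r ltr_pdivrMr.
have [N3 N3P] : exists N, forall r, (N <= r)%N -> w (f r) < 1.
  have [wz0|wz0] := eqVneq (w z) 0.
    by exists 0%N => r _; rewrite /f absvalM wz0 mulr0.
  have wz0' : 0 < w z by rewrite lt_def wz0 absval_ge0.
  have e0 : 0 < (w z)^-1 - 1 by rewrite subr_gt0 invf_gt1.
  have [N NP] := absval_big_limit wy e0; exists N => r /NP.
  set g := y ^+ r / _ => ge.
  have : w g < (w z)^-1.
    have := ler_absvalB w g 1; rewrite absval1 => H.
    by lra.
  by rewrite /f absvalM -[_^-1]mul1r ltr_pdivlMr.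
exists (f (maxn N1 (maxn N2 N3))).
  by apply: N2P; rewrite !leq_max leqnn !orbT.
move=> u; rewrite inE => /orP[/eqP ->|].
  by apply: N3P; rewrite !leq_max leqnn !orbT.
by apply: N1P; rewrite !leq_max leqnn.
Qed.

Lemma weak_approximation v (S : seq (absval R K)) (e : R) : 0 < e -> places v ->
  {in S, forall w, places w} -> v \notin S ->
  exists2 u, v (u - 1) < e & {in S, forall w : absval R K, w u < e}.
Proof.
move=> e0 pv pS vS; have [y vy Sy] := place_dominating pv pS vS.
have [N1 N1P] := absval_big_limit vy e0.
have [N2 N2P] : exists N, forall r, (N <= r)%N ->
    {in S, forall w : absval R K, w (y ^+ r / (1 + y ^+ r)) < e}.
  by apply: eventually_seq => w /Sy wy; exact: absval_small_limit.
exists (y ^+ (maxn N1 N2) / (1 + y ^+ (maxn N1 N2))).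
  by apply: N1P; rewrite leq_maxl.
by apply: N2P; rewrite leq_maxr.
Qed.

Lemma approximate_idempotents s (V : 'I_s -> absval R K) (e : R) : 0 < e ->
  injective V -> (forall i, places (V i)) -> exists u : 'I_s -> K,
    forall i, V i (u i - 1) < e /\ forall j, j != i -> V j (u i) < e.
Proof.
move=> e0 V_inj V_places.
suff /choice[u uP] (i : 'I_s) : exists x, V i (x - 1) < e /\
  forall j, j != i -> V j x < e by exists u.
have [||x xi xj] := @weak_approximation (V i) [seq V j | j <- enum 'I_s & j != i]
  e e0 (V_places i).
- by move=> w /mapP[j _ ->].
- apply/mapP => -[j]; rewrite mem_filter => /andP[ji _] /V_inj ij.
  by rewrite ij eqxx in ji.
exists x; split=> // j ji; apply: xj; apply: map_f.
by rewrite mem_filter ji mem_enum.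
Qed.

End Places.

(** * Local degrees *)

Lemma vector_axiom_of_bij (F : fieldType) (V : lmodType F) r (g : 'rV[F]_r -> V) :
  linear g -> injective g -> (forall x, exists y, g y = x) ->
  inhabited (Vector.axiom r V).
Proof.
move=> lg ig sg; have [f fg] := choice sg.
have gf : cancel g f by move=> y; apply: ig; rewrite fg.
constructor; exists f; last by exists g.
by move=> a x y; apply: ig; rewrite fg lg !fg.
Qed.

(** Invariance of dimension, which determines the value picked by [xget] in [local_degree]. *)
Lemma vector_axiom_le (F : fieldType) (V : lmodType F) r d :
  Vector.axiom r V -> Vector.axiom d V -> (r <= d)%N.
Proof.
move=> [f lf [f' ff' f'f]] [g lg [g' gg' g'g]].
have lin : linear (g \o f').
  by move=> a x y /=; rewrite -lg -[in RHS](ff' (_ + _)) lf !f'f.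
pose h : {linear 'rV[F]_r -> 'rV_d} := HB.pack (g \o f')
  (GRing.isLinear.Build _ _ _ _ _ lin).
have hI : injective h by apply: (can_inj (g := f \o g')) => x /=; rewrite gg' f'f.
have : row_free (lin1_mx h).
  rewrite -kermx_eq0; apply/eqP/row_matrixP => i; rewrite row0.
  by apply: hI; rewrite linear0 -mul_rV_lin1 -row_mul mulmx_ker row0.
by move=> /eqP <-; exact: rank_leq_col.
Qed.

Lemma lin_indep_le (K : fieldExtType rat) s (u : 'I_s -> K) :
  (forall a : 'I_s -> rat, \sum_i a i *: u i = 0 -> forall i, a i = 0) ->
  (s <= dim K)%N.
Proof.
move=> indep; pose A := \matrix_i v2r (u i).
have : row_free A.
  rewrite -kermx_eq0; apply/eqP/row_matrixP => i; rewrite row0.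
  have kA : row i (kermx A) *m A = 0 by rewrite -row_mul mulmx_ker row0.
  apply/rowP => j; rewrite [RHS]mxE; move: (row i (kermx A)) kA => x xA.
  apply: indep; apply: (can_inj v2rK); rewrite linear0 -xA mulmx_sum_row linear_sum.
  by apply: eq_bigr => k _; rewrite linearZ rowK.
by move=> /eqP <-; exact: rank_leq_col.
Qed.

Section LocalDegree.
Context {R : realType} {K : fieldExtType rat}.
Variable v : absval R K.

(** A form of linear independence over Q_v that refers to rational coefficients only; the uniform
    constant c lets it survive passage to the completion. *)
Definition separated_family r (e : 'I_r -> K) := exists2 c : R, 0 < c &
  forall (a : 'I_r -> rat) i, c * absval_rat v (a i) <= v (\sum_j a j *: e j).

Lemma separated_family_le r (e : 'I_r -> K) : separated_family e -> (r <= dim K)%N.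
Proof.
move=> [c c0 ce]; apply: (@lin_indep_le _ _ e) => a ae i.
have := ce a i; rewrite ae absval0 pmulr_rle0// => ai.
by apply/eqP; rewrite -(absval_eq0 (absval_rat v)) eq_le ai absval_ge0.
Qed.

(** Dividing a combination by its coefficient at x shows that its size s dominates d times that
    coefficient. Removing the x-term then leaves a combination of the e_i of size at most s (1 + v x
    / d), whence the constant. *)
Lemma separated_family_cons r (e : 'I_r -> K) (x : K) (d : R) :
  separated_family e -> 0 < d ->
  (forall a : 'I_r -> rat, d <= v (x - \sum_i a i *: e i)) ->
  separated_family (fun i : 'I_r.+1 => if unlift ord0 i is Some j then e j else x).
Proof.
move=> [c c0 ce] d0 xe.
have vx := absval_ge0 v x.
have M0 : 0 < 1 + v x / d by rewrite ltr_wpDr// divr_ge0// ltW.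
exists (Num.min d (c / (1 + v x / d))); first by rewrite lt_min d0 divr_gt0.
move=> a; rewrite big_ord_recl unlift_none.
rewrite (eq_bigr (fun j => a (lift ord0 j) *: e j)); last by move=> j _; rewrite liftK.
set b := a ord0; set y := \sum_(_ < _) _; set s := v (_ + _).
have bs : d * absval_rat v b <= s.
  have [->|b0] := eqVneq b 0; first by rewrite absval0 mulr0 absval_ge0.
  have -> : s = absval_rat v b * v (x - \sum_i (- b^-1 * a (lift ord0 i)) *: e i).
    rewrite -[absval_rat v b]/(v b%:A) -absvalM /s; congr (v _); rewrite /= mulrBr mulr_algl.
    rewrite mulr_algl scaler_sumr -sumrN; congr (_ + _); apply: eq_bigr => i _.
    by rewrite scalerA mulNr mulrN mulVKf// scaleNr opprK.
  by rewrite mulrC ler_wpM2l ?absval_ge0.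
move=> i; have [j ->|->] := unliftP ord0 i; last first.
  by apply: le_trans bs; rewrite ler_wpM2r ?absval_ge0// ge_min lexx.
have yj := ce (fun j => a (lift ord0 j)) j; rewrite -/y in yj.
have ys : v y <= s * (1 + v x / d).
  have -> : y = (b *: x + y) - b *: x by rewrite addrC addKr.
  rewrite (le_trans (ler_absvalD _ _ _))// absvalN -/s mulrDr mulr1 lerD2l.
  rewrite -mulr_algl absvalM -[v _%:A]/(absval_rat v b) mulrCA.
  by rewrite [leLHS]mulrC ler_wpM2l// ler_pdivlMr// mulrC.
rewrite (@le_trans _ _ (c / (1 + v x / d) * absval_rat v (a (lift ord0 j))))//.
  by rewrite ler_wpM2r ?absval_ge0// ge_min lexx orbT.
by rewrite mulrAC ler_pdivrMr// (le_trans yj).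
Qed.

Fact const_cauchy_subproof (x : K) : (fun _ : nat => x) \in cauchy_pred v.
Proof. by apply/asboolP => e e0; exists 0%N => i j _ _; rewrite subrr absval0. Qed.

Definition const_cauchy (x : K) : cauchy v := Cauchy (const_cauchy_subproof x).

Definition completion_comb r (e : 'I_r -> K) (y : 'rV[completion (absval_rat v)]_r) :
  (completion v : lmodType (completion (absval_rat v))) :=
  \sum_i y 0 i *: (cauchy_lim (const_cauchy (e i)) :
    (completion v : lmodType (completion (absval_rat v)))).

Definition comb_seq r (e : 'I_r -> K) (a : 'I_r -> cauchy (absval_rat v)) : cauchy v :=
  \sum_i @cauchy_map _ _ _ (in_alg K) v (a i) * const_cauchy (e i).

Lemma comb_seqE r (e : 'I_r -> K) a n : comb_seq e a n = \sum_i a i n *: e i.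
Proof.
rewrite /comb_seq; transitivity
  (\sum_i (@cauchy_map _ _ _ (in_alg K) v (a i) * const_cauchy (e i)) n).
  by elim/big_ind2: _ => // x1 x2 y1 y2 <- <-.
by apply: eq_bigr => i _; rewrite -mulr_algl.
Qed.

Lemma completion_comb_lim r (e : 'I_r -> K) a :
  completion_comb e (\row_i cauchy_lim (a i)) = cauchy_lim (comb_seq e a).
Proof.
rewrite /completion_comb /comb_seq rmorph_sum; apply: eq_bigr => i _.
rewrite mxE rmorphM; congr (_ * _).
exact: (@completion_map_lim _ _ _ (in_alg K) v (a i)).
Qed.

Lemma completion_comb_linear r (e : 'I_r -> K) : linear (completion_comb e).
Proof.
move=> a x y; rewrite /completion_comb scaler_sumr -big_split; apply: eq_bigr => i _.
by rewrite !mxE scalerDl scalerA.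
Qed.

(** Along representing Cauchy sequences, separation forces every coordinate to tend to 0 as soon as
    the combination does. *)
Lemma completion_comb_inj r (e : 'I_r -> K) :
  separated_family e -> injective (completion_comb e).
Proof.
move=> [c c0 ce]; pose g : {linear _ -> _} := HB.pack (completion_comb e)
  (GRing.isLinear.Build _ _ _ _ _ (completion_comb_linear e)).
apply: (raddf_inj (f := g)) => y /= gy0.
pose a i := cauchy_repr (y 0 i).
have yE : y = \row_i cauchy_lim (a i) by apply/rowP => i; rewrite mxE cauchy_reprK.
move: gy0; rewrite {1}yE completion_comb_lim -(rmorph0 (@cauchy_lim _ _ v)) => /eqP.
rewrite cauchy_lim_eq subr0 => /asboolP null.
apply/rowP => i; rewrite [RHS]mxE -(cauchy_reprK (y 0 i)) -/(a i).
apply/eqP; rewrite -(rmorph0 (@cauchy_lim _ _ (absval_rat v))) cauchy_lim_eq subr0.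
apply/asboolP => d d0; have [N NP] := null (c * d) (mulr_gt0 c0 d0).
exists N => n /NP; rewrite comb_seqE => lt_cd.
by rewrite -(ltr_pM2l c0) (le_lt_trans (ce (fun j => a j n) i)).
Qed.

Lemma completion_comb_surj r (e : 'I_r -> K) : separated_family e ->
  (forall x d, 0 < d -> exists a : 'I_r -> rat, v (x - \sum_i a i *: e i) < d) ->
  forall x, exists y, completion_comb e y = x.
Proof.
move=> [c c0 ce] dense x; pose xs := cauchy_repr x.
have /choice[a aP] (n : nat) := dense (xs n) n.+1%:R^-1 (ltac:(by rewrite invr_gt0 ltr0n)).
have small (d : R) : 0 < d -> exists N, forall n, (N <= n)%N -> n.+1%:R^-1 < d.
  move=> d0; exists (Num.truncn d^-1) => n Nn.
  rewrite -[ltRHS]invrK ltf_pV2 ?posrE ?invr_gt0//.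
  by apply: lt_le_trans (truncnS_gt _) _; rewrite ler_nat.
have ac i : (fun n => a n i) \in cauchy_pred (absval_rat v).
  (* One third for the Cauchy difference of [xs], one for each of the two approximation errors. *)
  apply/asboolP => d d0; have cd0 : 0 < c * d / 3 by rewrite divr_gt0 ?mulr_gt0.
  have [N NP] := small _ cd0; have [M MP] := cauchyP xs cd0.
  exists (maxn N M) => n m; rewrite !geq_max => /andP[Nn Mn] /andP[Nm Mm].
  rewrite -(ltr_pM2l c0) (le_lt_trans (ce (fun j => a n j - a m j) i))//.
  have -> : \sum_j (a n j - a m j) *: e j =
      (xs n - xs m) - (xs n - \sum_j a n j *: e j) + (xs m - \sum_j a m j *: e j).
    rewrite (eq_bigr (fun j => a n j *: e j - a m j *: e j)); last first.
      by move=> j _; rewrite scalerBl.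
    by rewrite sumrB; ring.
  rewrite (le_lt_trans (ler_absvalD _ _ _))//.
  have := ler_absvalD v (xs n - xs m) (- (xs n - \sum_j a n j *: e j)).
  rewrite absvalN; have := aP n; have := aP m; have := NP n Nn; have := NP m Nm.
  have := MP n m Mn Mm.
  set r1 := v _; set r2 := n.+1%:R^-1; set r3 := m.+1%:R^-1; set r4 := v _; set r5 := v _.
  set r6 := v _; lra.
pose as_ i := Cauchy (ac i).
exists (\row_i cauchy_lim (as_ i)); rewrite completion_comb_lim -[RHS]cauchy_reprK.
apply/eqP; rewrite cauchy_lim_eq; apply/asboolP => d d0.
have [N NP] := small d d0; exists N => n /NP nd.
have -> : (comb_seq e as_ - cauchy_repr x) n = comb_seq e as_ n - xs n by [].
by rewrite comb_seqE absvalBC; apply: lt_trans nd; exact: aP.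
Qed.

(* A separated family of maximal size is a basis of K_v: by maximality its    *)
(* rational combinations are v-dense in K, and separation turns a v-Cauchy    *)
(* sequence of combinations into Cauchy sequences of coordinates.             *)
Lemma local_degreeP :
  (exists e : 'I_(local_degree v) -> K, separated_family e) /\
  (forall r (e : 'I_r -> K), separated_family e -> (r <= local_degree v)%N).
Proof.
pose Q r := `[< exists e : 'I_r -> K, separated_family e >].
have Q0 : exists r, Q r.
  by exists 0%N; apply/asboolP; exists (fun=> 0); exists 1 => // ? [].
have Qle r : Q r -> (r <= dim K)%N by move=> /asboolP[e /separated_family_le].
case: (ex_maxnP Q0 Qle) => r /asboolP[e sep_e] rmax.
have dense x d : 0 < d -> exists a : 'I_r -> rat, v (x - \sum_i a i *: e i) < d.
  move=> d0; apply: contrapT => H; suff /rmax : Q r.+1 by rewrite ltnn.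
  apply/asboolP; eexists; apply: (separated_family_cons sep_e (x := x) d0) => a.
  by rewrite leNgt; apply/negP => ?; apply: H; exists a.
have [ax] := vector_axiom_of_bij (completion_comb_linear e) (completion_comb_inj sep_e)
  (completion_comb_surj sep_e dense).
have degE : local_degree v = r.
  rewrite /local_degree; case: xgetP => [d _ [axd]|/(_ r) []]; last by constructor.
  by apply/eqP; rewrite eqn_leq !(vector_axiom_le axd ax, vector_axiom_le ax axd).
rewrite degE; split; first by exists e.
by move=> s f sep_f; apply: rmax; apply/asboolP; exists f.
Qed.

End LocalDegree.

(** * The nonarchimedean contribution *)

Lemma Aint_monic_root (K : fieldExtType rat) (iota : {rmorphism K -> algC}) x :
  iota x \in Aint -> exists2 p : {poly int}, p \is monic & root (map_poly intr p) x.
Proof.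
move=> /floorpP[p pE]; have [q [qE qmon] _] := minCpolyP (iota x).
have mon : map_poly intr p \is @monic algC by rewrite -pE qE map_monic.
exists p.
  move: mon; rewrite !monicE (lead_coef_map_inj (@intr_inj algC))//.
  by rewrite -[X in _ == X](rmorph1 intr) eqr_int.
rewrite -(fmorph_root iota) -map_poly_comp.
rewrite (eq_map_poly (g := intr)) => [|z]; last by rewrite /= rmorph_int.
by rewrite -pE root_minCpoly.
Qed.

Section Nonarch.
Context {R : realType} {K : fieldExtType rat}.
Implicit Types v w : absval R K.

(** Reducing X^N modulo p writes x^N as an integral combination of boundedly many powers of x, which
    bounds |x|^N independently of N. *)
Lemma integral_absval_le1 v (p : {poly int}) x :
  (forall z : int, v z%:~R <= 1) -> p \is monic -> root (map_poly intr p) x -> v x <= 1.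
Proof.
move=> vz pmon px; rewrite leNgt; apply/negP => vx.
pose n := size p.
have [N NP] := expr_gt_eventually (\sum_(j < n) v x ^+ j) vx.
have := NP N (leqnn _); rewrite ltNge => /negP; apply.
pose r := Pdiv.Ring.rmodp ('X^N) p.
have xN : x ^+ N = \sum_(j < n) (r`_j)%:~R * x ^+ j.
  have /(congr1 (fun q => (map_poly intr q : {poly K}).[x])) :=
    Pdiv.RingMonic.rdivp_eq pmon 'X^N.
  rewrite rmorphD rmorphM hornerD hornerM (eqP px) mulr0 add0r.
  rewrite map_polyXn hornerXn => ->; rewrite (@horner_coef_wide _ n) => [|].
    by apply: eq_bigr => j _; rewrite coef_map.
  rewrite (leq_trans (size_poly _ _))// ltnW// Pdiv.Ring.ltn_rmodpN0//.
  exact: monic_neq0.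
rewrite -absvalX xN (le_trans (absval_sum _ _ _ _))// ler_sum// => j _.
by rewrite absvalM absvalX ler_piMl// exprn_ge0// absval_ge0.
Qed.

Lemma nonarch_padic v : nonarch_places v -> exists p, padic_place p v.
Proof.
move=> [/placesP[va|//] vmax]; have := vmax 1 1.
rewrite absval1 maxxx -(natrD _ 1 1) arch_nat// => H.
by exfalso; move: H; apply/negP; rewrite -ltNge; lra.
Qed.

Lemma nonarch_sum v (I : finType) (F : I -> K) (b : R) : nonarch_places v ->
  0 <= b -> (forall i, v (F i) <= b) -> v (\sum_i F i) <= b.
Proof.
move=> [_ vmax] b0 Fb; apply: (big_ind (fun z => v z <= b)) => //.
  by rewrite absval0.
by move=> x y xb yb; rewrite (le_trans (vmax _ _))// ge_max xb yb.
Qed.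

Lemma mul_mxM (a b : K) : mul_mx (a * b) = mul_mx a *m mul_mx b.
Proof.
apply/row_matrixP => i; rewrite !rowE mulmxA; apply: r2v_inj.
by rewrite !mul_mx_r2v mulrA.
Qed.

Lemma det_mul_mxX (a : K) n : \det (mul_mx (a ^+ n)) = \det (mul_mx a) ^+ n.
Proof.
elim: n => [|n IHn]; last by rewrite !exprS mul_mxM det_mulmx IHn.
rewrite !expr0 -[RHS](det1 rat (dim K)); congr (\det _); apply/row_matrixP => i.
by rewrite !rowE; apply: r2v_inj; rewrite mul_mx_r2v mulr1 mulmx1.
Qed.

(** Multiplying a maximal separated family by a power of m makes it integral at v and only rescales
    its constant. *)
Lemma place_separated_integral v (m : nat) : v m%:R < 1 -> 0 < v m%:R ->
  exists e : 'I_(local_degree v) -> K, (forall i, v (e i) <= 1) /\ separated_family v e.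
Proof.
move=> vm vm0; have [[e [c c0 ce]] _] := local_degreeP v.
have [N NP] : exists N, forall r, (N <= r)%N ->
    {in enum 'I_(local_degree v), forall i, v (m%:R ^+ r * e i) <= 1}.
  apply: eventually_seq => i _.
  have e0 : 0 < (v (e i) + 1)^-1 by rewrite invr_gt0 ltr_wpDl ?absval_ge0.
  have [N NP] := expr_lt_eventually (absval_ge0 v m%:R) vm e0.
  exists N => r /NP; rewrite -[_^-1]mul1r ltr_pdivlMr; last first.
    by rewrite ltr_wpDl ?absval_ge0.
  rewrite absvalM absvalX; have := absval_ge0 v (e i).
  have := exprn_ge0 r (absval_ge0 v m%:R); nra.
exists (fun i => m%:R ^+ N * e i); split.
  by move=> i; apply: (NP N (leqnn _)); rewrite mem_enum.
exists (c * v m%:R ^+ N); first by rewrite mulr_gt0// exprn_gt0.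
move=> a i.
rewrite (eq_bigr (fun j => m%:R ^+ N * (a j *: e j))) => [|j _]; last by rewrite scalerAr.
rewrite -mulr_sumr absvalM absvalX mulrAC mulrC.
by rewrite ler_wpM2l ?exprn_ge0 ?absval_ge0.
Qed.

End Nonarch.

Section CountingBound.
Context {R : realType} {K : fieldExtType rat}.
Variables (s m : nat) (V : 'I_s -> absval R K).
Hypotheses (V_inj : injective V) (V_nonarch : forall i, nonarch_places (V i)).
Hypotheses (V_m : forall i, V i m%:R < 1) (m_gt0 : (0 < m)%N).
Variables (d : 'I_s -> nat) (e : forall i, 'I_(d i) -> K) (c : 'I_s -> R).
Arguments e : clear implicits.
Hypotheses (c_gt0 : forall i, 0 < c i) (e_le1 : forall i j, V i (e i j) <= 1).
Hypothesis e_sep : forall i (a : 'I_(d i) -> rat) j,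
  c i * absval_rat (V i) (a j) <= V i (\sum_k a k *: e i k).

Lemma V_m_gt0 i : 0 < V i m%:R.
Proof.
by rewrite absval_gt0 -(rmorph_nat (in_alg K)) fmorph_eq0 pnatr_eq0 -lt0n.
Qed.

Let V_int_le1 i (z : int) : V i z%:~R <= 1.
Proof. by have [p vp] := nonarch_padic (V_nonarch i); exact: padic_int_le1 vp. Qed.

Definition S_integral (x : K) := forall i, V i x <= 1.

Lemma S_integral_full x : exists2 D : nat, (0 < D)%N & S_integral (x *+ D).
Proof.
have [N NP] : exists N, forall r, (N <= r)%N ->
    {in enum 'I_s, forall i, V i (m%:R ^+ r * x) <= 1}.
  apply: eventually_seq => i _.
  have e0 : 0 < (V i x + 1)^-1 by rewrite invr_gt0 ltr_wpDl ?absval_ge0.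
  have [N NP] := expr_lt_eventually (ltW (V_m_gt0 i)) (V_m i) e0.
  exists N => r /NP; rewrite -[_^-1]mul1r ltr_pdivlMr; last first.
    by rewrite ltr_wpDl ?absval_ge0.
  rewrite absvalM absvalX; have := absval_ge0 (V i) x.
  have := exprn_ge0 r (ltW (V_m_gt0 i)); nra.
exists (m ^ N)%N; first by rewrite expn_gt0 m_gt0.
move=> i; rewrite -mulr_natl natrX; apply: (NP N (leqnn _)).
by rewrite mem_enum.
Qed.

Variables (g : K) (p : {poly int}) (q : 'I_s -> nat).
Hypotheses (g_neq0 : g != 0) (p_monic : p \is monic) (p_root : root (map_poly intr p) g).
Hypothesis q_gt0 : forall i, (0 < q i)%N.
(** For q i = 1 the only digit is 0, so nothing has to be distinguished at that place. *)
Hypothesis q_small : forall i, (1 < q i)%N -> V i g < c i / (4 * (q i)%:R).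

Let comb (u : 'I_s -> K) (b : forall i, 'I_(d i) -> int) : K :=
  \sum_i u i * \sum_(j < d i) (b i j)%:~R *: e i j.

(** B bounds every inner sum at every place and Q bounds every q_i / c_i, so eps B = 1/(4Q) is at
    most c_i / (4 q_i): cross terms between different places become negligible. *)
Let B : R := 1 + \sum_i \sum_k \sum_(j < d k) V i (e k j).
Let Q : R := 1 + \sum_i (q i)%:R / c i.
Let eps : R := (4 * Q * B)^-1.

Let B_ge1 : 1 <= B.
Proof.
rewrite lerDl; apply: sumr_ge0 => i _; apply: sumr_ge0 => k _.
by apply: sumr_ge0 => j _; exact: absval_ge0.
Qed.

Let inner_sum_le_B i k (b : 'I_(d k) -> int) :
  V i (\sum_(j < d k) (b j)%:~R *: e k j) <= B.
Proof.
have S0 i' k' : 0 <= \sum_(j < d k') V i' (e k' j).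
  by apply: sumr_ge0 => j _; exact: absval_ge0.
apply: (@le_trans _ _ (\sum_(j < d k) V i (e k j))).
  rewrite (le_trans (absval_sum _ _ _ _))// ler_sum// => j _.
  rewrite -mulr_algl absvalM ler_piMl ?absval_ge0//.
  by rewrite -[_%:A]/(in_alg K _) rmorph_int V_int_le1.
apply: (@le_trans _ _ (\sum_k \sum_(j < d k) V i (e k j))).
  by rewrite [leRHS](bigD1 k)//= lerDl; apply: sumr_ge0 => k' _; exact: S0.
rewrite /B [X in _ <= _ + X](bigD1 i)//= addrCA lerDl addr_ge0//.
by apply: sumr_ge0 => i' _; apply: sumr_ge0 => k' _; exact: S0.
Qed.

Let inner_sum_le1 i (b : 'I_(d i) -> int) :
  V i (\sum_(j < d i) (b j)%:~R *: e i j) <= 1.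
Proof.
apply: nonarch_sum => // j; rewrite -mulr_algl absvalM mulr_ile1 ?absval_ge0//.
by rewrite -[_%:A]/(in_alg K _) rmorph_int V_int_le1.
Qed.

Let Q_ge1 : 1 <= Q.
Proof. by rewrite lerDl; apply: sumr_ge0 => i _; rewrite divr_ge0// ltW. Qed.

Let Q_ge i : (q i)%:R / c i <= Q.
Proof.
rewrite /Q (bigD1 i)//= addrCA lerDl addr_ge0//.
by apply: sumr_ge0 => k _; rewrite divr_ge0// ltW.
Qed.

Let eps_gt0 : 0 < eps.
Proof. by rewrite invr_gt0 !mulr_gt0// (lt_le_trans ltr01) ?Q_ge1 ?B_ge1. Qed.

Let epsB : eps * B = (4 * Q)^-1.
Proof.
have B1 := B_ge1; have Q1 := Q_ge1; rewrite /eps invfM -mulrA mulVf ?mulr1//.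
by rewrite gt_eqF// (lt_le_trans ltr01).
Qed.

Let epsB_le : eps * B <= 4^-1.
Proof. by rewrite epsB lef_pV2 ?posrE; have := Q_ge1; lra. Qed.

Let eps_le : eps <= 4^-1.
Proof. by apply: le_trans epsB_le; rewrite ler_peMr ?B_ge1// ltW// eps_gt0. Qed.

Section Digits.
Variable u : 'I_s -> K.
Hypothesis uP : forall i, V i (u i - 1) < eps /\ forall j, j != i -> V j (u i) < eps.

Let off_diagonal_le i k (b : 'I_(d k) -> int) : k != i ->
  V i (u k * \sum_(j < d k) (b j)%:~R *: e k j) <= eps * B.
Proof.
move=> ki; rewrite absvalM ler_pM ?absval_ge0 ?inner_sum_le_B//.
by apply/ltW/(uP k).2; rewrite eq_sym.
Qed.

Let comb_S_integral b : S_integral (comb u b).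
Proof.
move=> i; apply: nonarch_sum => // k; have [->|ki] := eqVneq k i; last first.
  by apply: le_trans (off_diagonal_le _ ki) _; apply: le_trans epsB_le _; lra.
rewrite absvalM mulr_ile1 ?absval_ge0 ?inner_sum_le1// -(subrK 1 (u i)).
rewrite (le_trans ((V_nonarch i).2 _ _))// absval1 ge_max lexx andbT.
by have := (uP i).1; have := eps_le; lra.
Qed.

(** A nonzero integer of absolute value below q_i has p-adic absolute value at least 1/q_i, so by
    separation the i-th inner sum has size at least c_i/q_i. Multiplying by u_i keeps 3/4 of this,
    the other places take away at most 1/4, and |g| lies below 1/4 of it. *)
Let comb_lower i (b : forall i, 'I_(d i) -> int) j :
  b i j != 0 -> `|b i j| < (q i)%:R -> V i g < V i (comb u b).
Proof.
move=> b0 bq; set y := \sum_(k < d i) (b i k)%:~R *: e i k.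
have q1 : (1 < q i)%N.
  rewrite -(ltr_nat int) (le_lt_trans _ bq)//.
  by rewrite -gtz0_ge1 normr_gt0.
have q0 : 0 < (q i)%:R :> R by rewrite ltr0n.
have y_ge : c i / (q i)%:R <= V i y.
  apply: le_trans (e_sep (fun k => (b i k)%:~R) j).
  rewrite ler_wpM2l ?(ltW (c_gt0 i))// absval_ratE rmorph_int.
  have [pr vp] := nonarch_padic (V_nonarch i).
  apply: le_trans (padic_int_ge vp b0).
  rewrite lef_pV2 ?posrE ?ltr0z ?normr_gt0//.
  by rewrite pmulrn ler_int ltW// -natz.
have rest : V i (\sum_(k | k != i) u k * \sum_(j < d k) (b k j)%:~R *: e k j) <= eps * B.
  rewrite big_mkcond; apply: nonarch_sum => //.
    by rewrite mulr_ge0 ?(ltW eps_gt0)// (le_trans ler01) ?B_ge1.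
  move=> k; case: ifP => [ki|_]; first exact: off_diagonal_le.
  by rewrite absval0 mulr_ge0 ?(ltW eps_gt0)// (le_trans ler01) ?B_ge1.
have restq : eps * B <= 4^-1 * (c i / (q i)%:R).
  rewrite epsB invfM ler_wpM2l ?invr_ge0// -[leRHS]invf_div lef_pV2 ?Q_ge// posrE.
    by rewrite (lt_le_trans ltr01) ?Q_ge1.
  by rewrite divr_gt0.
have gq := q_small q1; rewrite invfM mulrCA in gq.
have ui : 1 - eps <= V i (u i).
  have := ler_absvalB (V i) 1 (1 - u i); rewrite absval1 subKr absvalBC.
  by have := (uP i).1; lra.
rewrite /comb (bigD1 i)//= -/y; move: rest; set z := \sum_(k | _) _ => rest.
have := ler_absvalB (V i) (u i * y) (- z); rewrite opprK absvalN absvalM => low.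
apply: lt_le_trans low.
have el := eps_le; have cq : 0 < c i / (q i)%:R by rewrite divr_gt0.
have : 3 / 4 * (c i / (q i)%:R) <= V i (u i) * V i y.
  by rewrite ler_pM//; lra.
by lra.
Qed.

(* The sums of u_i a_ij e_ij with digits 0 <= a_ij < q_i are pairwise          *)
(* incongruent modulo g: at a place V i where two digit vectors differ, the   *)
(* difference is at least c_i / (4 q_i), because u_i is close to 1 there and  *)
(* the other u_k are close to 0.                                              *)
Lemma counting_bound_aux : (\prod_i q i ^ d i)%:R <= `|\det (mul_mx g)|.
Proof.
pose T := {dffun forall x : {i : 'I_s & 'I_(d i)}, 'I_(q (tag x))}.
pose dig (a : T) i (j : 'I_(d i)) : int := a (Tagged (fun i => 'I_(d i)) j).
pose t (a : T) : K := comb u (dig a).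
have tB (a a' : T) : t a - t a' = comb u (fun i j => dig a i j - dig a' i j).
  rewrite /t /comb -sumrB; apply: eq_bigr => i _; rewrite -mulrBr -sumrB.
  by congr (_ * _); apply: eq_bigr => j _; rewrite intrB scalerBl.
have key (a a' : T) : (exists2 z, S_integral z & t a - t a' = z * g) -> a = a'.
  move=> [z zP aa']; apply/ffunP => -[i j]; apply/val_inj/eqP.
  rewrite -[_ == _]/((dig a i j == dig a' i j)) -subr_eq0.
  apply/negP => /negP bij; have := @comb_lower i (fun i j => dig a i j - dig a' i j) j bij.
  rewrite -tB aa' absvalM => H.
  have /H : `|dig a i j - dig a' i j| < (q i)%:R.
    have := ltn_ord (a (Tagged (fun i => 'I_(d i)) j)).
    have := ltn_ord (a' (Tagged (fun i => 'I_(d i)) j)).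
    rewrite /dig /= natz; lia.
  rewrite ltNge => /negP; apply.
  by rewrite ler_piMl ?absval_ge0// zP.
have SB x y : S_integral x -> S_integral y -> S_integral (x - y).
  move=> Sx Sy i; rewrite (le_trans ((V_nonarch i).2 _ _))// absvalN.
  by rewrite ge_max Sx Sy.
have Sg x : S_integral x -> S_integral (x * g).
  move=> Sx i; rewrite absvalM mulr_ile1 ?absval_ge0//.
  by apply: integral_absval_le1 p_monic p_root; exact: V_int_le1.
have S0 : S_integral 0 by move=> i; rewrite absval0.
have t_inj : injective t by move=> a a' aa; apply: key; exists 0; rewrite ?aa ?subrr ?mul0r.
have := @size_incongruent K g p S_integral [seq t a | a <- enum T] g_neq0 p_monic p_root
  S0 SB Sg S_integral_full.
rewrite size_map -cardE card_dep_ffun foldrE big_map big_enum /=.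
rewrite (eq_bigr (fun x : {i : 'I_s & 'I_(d i)} => q (tag x))) => [|x _]; last by rewrite card_ord.
have -> : (\prod_(x : {i : 'I_s & 'I_(d i)}) q (tag x) = \prod_i q i ^ d i)%N.
  transitivity (\prod_i \prod_(j < d i) q i)%N; first by rewrite sig_big_dep.
  by apply: eq_bigr => i _; rewrite prod_nat_const card_ord.
apply; first by rewrite map_inj_uniq ?enum_uniq.
  by move=> _ /mapP[a _ ->]; exact: comb_S_integral.
by move=> _ _ /mapP[a _ ->] /mapP[a' _ ->] /key ->.
Qed.

End Digits.

Lemma counting_bound : (\prod_i q i ^ d i)%:R <= `|\det (mul_mx g)|.
Proof.
have [u uP] := approximate_idempotents eps_gt0 V_inj (fun i => (V_nonarch i).1).
exact: counting_bound_aux uP.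
Qed.

End CountingBound.

Lemma ge1_of_expr_bounded_below (R : realType) (a C : R) : 0 < C -> 0 <= a ->
  (forall k, C <= a ^+ k) -> 1 <= a.
Proof.
move=> C0 a0 Ca; rewrite leNgt; apply/negP => a1.
have [N NP] := expr_lt_eventually a0 a1 C0.
by have := NP N (leqnn _); rewrite ltNge Ca.
Qed.

(* Counting modulo b^k with q_i of order |b|_i^-k gives the inequality up to  *)
(* a constant independent of k; letting k grow removes the constant.          *)
Lemma nonarch_norm_bound (R : realType) (K : fieldExtType rat) (iota : {rmorphism K -> algC})
    (S : seq (absval R K)) (m : nat) (b : K) :
  uniq S -> {in S, forall v, places_dvd m v} -> (0 < m)%N -> b != 0 -> iota b \in Aint ->
  1 <= ratr `|\det (mul_mx b)| * \prod_(v <- S) v b ^+ local_degree v.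
Proof.
move=> uS Sm m0 b0 bint.
pose V i : absval R K := tnth (in_tuple S) i.
have VS i : places_dvd m (V i) by apply: Sm; exact: mem_tnth.
have V_inj : injective V by apply/tuple_uniqP.
have V_nonarch i := (VS i).1; have V_m i := (VS i).2.
have /fin_all_exists[e eP] i := place_separated_integral (V_m i) (V_m_gt0 V m0 i).
have /fin_all_exists2[c c0 ce] i := (eP i).2.
rewrite big_tnth; set r := \prod_(_ < _) _.
pose C := \prod_i (c i / 16) ^+ local_degree (V i).
apply: (@ge1_of_expr_bounded_below _ _ C).
- by apply: prodr_gt0 => i _; rewrite exprn_gt0 ?divr_gt0.
- rewrite mulr_ge0//; first by rewrite ler0q.
  by apply: prodr_ge0 => i _; rewrite exprn_ge0 ?absval_ge0.
move=> k; have [p p_monic p_root] : exists2 p : {poly int}, p \is monic &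
    root (map_poly intr p) (b ^+ k).
  by apply: (@Aint_monic_root _ iota); rewrite rmorphXn rpredX.
(* If q_i > 1 then q_i <= 2 X_i, which gives |b|^k <= c_i / (8 q_i) as counting requires; q_i > X_i
   gives q_i |b|^k > c_i / 16, the factor in C. *)
pose X i := c i / (16 * V i b ^+ k).
have Vb i : 0 < V i b ^+ k by rewrite exprn_gt0// absval_gt0.
have X0 i : 0 < X i by rewrite divr_gt0 ?mulr_gt0.
pose q i := (Num.truncn (X i)).+1.
have Xq i : X i < (q i)%:R by exact: truncnS_gt.
have q_small i : (1 < q i)%N -> V i (b ^+ k) < c i / (4 * (q i)%:R).
  move=> q1; have q2 : (q i)%:R <= 2 * X i.
    have : (Num.truncn (X i))%:R <= X i by rewrite truncn_le ltW.
    have : 1 <= (Num.truncn (X i))%:R :> R by rewrite ler1n.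
    by rewrite /q -natr1; lra.
  have q0 : 0 < (q i)%:R :> R by rewrite ltr0n.
  rewrite absvalX ltr_pdivlMr ?mulr_gt0//.
  have XE : X i * (16 * V i b ^+ k) = c i by rewrite divfK ?mulf_neq0 ?gt_eqF.
  have := Vb i; have := c0 i; nra.
have := @counting_bound R K _ m V V_inj V_nonarch V_m m0 _ e c c0 (fun i => (eP i).1) ce
  (b ^+ k) p q _ p_monic p_root _ q_small.
rewrite expf_neq0// det_mul_mxX => /(_ isT (fun=> isT)) bound.
have {}bound : \prod_i (q i)%:R ^+ local_degree (V i) <= ratr `|\det (mul_mx b)| ^+ k :> R.
  rewrite -rmorphXn -normrX; apply: le_trans (_ : ratr (\prod_i q i ^ local_degree (V i))%:R <= _).
    by rewrite ratr_nat natr_prod ler_prod// => i _; rewrite natrX lexx exprn_ge0.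
  by rewrite ler_rat.
rewrite exprMn; apply: le_trans (ler_wpM2r _ bound); last first.
  by rewrite exprn_ge0//; apply: prodr_ge0 => i _; rewrite exprn_ge0 ?absval_ge0.
rewrite /r -prodrXl -big_split; apply: ler_prod => i _ /=.
have c16 : 0 <= c i / 16 by rewrite divr_ge0// ltW.
rewrite exprn_ge0//= -exprM mulnC exprM -exprMn -/(V i).
have le : c i / 16 <= (q i)%:R * V i b ^+ k.
  by have := Xq i; rewrite /X ltr_pdivrMr ?mulr_gt0//; lra.
by rewrite lerXn2r ?nnegrE// (le_trans c16).
Qed.

(** * The archimedean contribution *)

Section ComplexNorm.
Variable R : realType.
Implicit Type z : complex R.

Lemma normc_norm z : (normc z)%:C%C = `|z|.
Proof. by case: z. Qed.

Lemma normc_ge0 z : 0 <= normc z.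
Proof. by case: z => a b; exact: sqrtr_ge0. Qed.

Lemma normc_eq0 z : (normc z == 0) = (z == 0).
Proof.
by apply/eqP/eqP => [/eq0_normc//|->]; exact: normc0.
Qed.

Lemma normc_sqr z : normc z ^+ 2 = complex.Re z ^+ 2 + complex.Im z ^+ 2.
Proof. by case: z => a b; rewrite sqr_sqrtr ?addr_ge0 ?sqr_ge0. Qed.

Lemma normc_ge_Im z : `|complex.Im z| <= normc z.
Proof.
rewrite -ler_sqr ?nnegrE ?normc_ge0// real_normK ?num_real//.
by rewrite normc_sqr lerDr sqr_ge0.
Qed.

Lemma normc_rat (q : rat) : normc (ratr q : complex R) = ratr `|q|.
Proof.
have -> : (ratr q : complex R) = (ratr q : R)%:C%C.
  exact/esym/(fmorph_eq_rat (real_complex R \o ratr)).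
by rewrite /= expr0n addr0 sqrtr_sqr ratr_norm.
Qed.

Variables (K : fieldExtType rat) (f : {rmorphism K -> complex R}).

Definition embedding_absval : absval R K := @Absval R K (@normc R \o f)
  (fun x => normc_ge0 (f x))
  (fun x => etrans (normc_eq0 (f x)) (fmorph_eq0 f x))
  (fun x y => etrans (congr1 (@normc R) (rmorphM f x y)) (normcM (f x) (f y)))
  (fun x y => eq_ind_r (fun z => normc z <= normc (f x) + normc (f y))
     (le_normcD (f x) (f y)) (rmorphD f x y)).

Lemma embedding_ratE (q : rat) : f (in_alg K q) = ratr q.
Proof. exact: (fmorph_eq_rat (f \o in_alg K)). Qed.

Lemma embedding_arch : arch_place embedding_absval.
Proof. by move=> q; rewrite absval_ratE /= embedding_ratE normc_rat. Qed.

End ComplexNorm.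

Section ArchPlaces.
Context {R : realType} {K : fieldExtType rat}.
Implicit Types v w : absval R K.

Lemma arch_place_place v : arch_place v -> places v.
Proof. by left. Qed.

(** Approximate idempotents at the places of S are linearly independent over Q: in a relation, the
    term with the largest coefficient dominates at its own place, where the others together are too
    small. *)
Lemma arch_places_size (S : seq (absval R K)) : uniq S ->
  {in S, forall v, arch_place v} -> (size S <= dim K)%N.
Proof.
move=> uS Sarch; pose V i : absval R K := tnth (in_tuple S) i.
have V_inj : injective V by apply/tuple_uniqP.
have V_arch i : arch_place (V i) by apply: Sarch; exact: mem_tnth.
pose eps : R := (2 * (size S).+1%:R)^-1.
have s1 : 1 <= (size S).+1%:R :> R by rewrite ler1n.
have eps0 : 0 < eps by rewrite invr_gt0 mulr_gt0.
have epsE : eps * (size S).+1%:R = 2^-1.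
  by rewrite /eps invfM -mulrA mulVf ?mulr1// gt_eqF// (lt_le_trans ltr01).
have [u uP] := approximate_idempotents eps0 V_inj (fun i => arch_place_place (V_arch i)).
apply: (@lin_indep_le _ _ u) => a a0.
suff small i : a i = 0 by [].
have [i0 _ imax] : exists2 i0 : 'I_(size S), true & forall j, `|a j| <= `|a i0|.
  by case: (@arg_maxP _ _ _ i predT (fun j => `|a j|) isT) => i0 _ H; exists i0 => // j; exact: H.
have va j q : V j (in_alg K q) = ratr `|q| by rewrite -absval_ratE V_arch.
have rest : V i0 (\sum_(j | j != i0) a j *: u j) <= \sum_(j | j != i0) ratr `|a i0| * eps.
  rewrite (le_trans (absval_sum _ _ _ _))// ler_sum// => j ji.
  rewrite -mulr_algl absvalM va ler_pM ?ler_rat ?ler0q ?absval_ge0 ?imax//.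
  by apply/ltW/(uP j).2; rewrite eq_sym.
have main : V i0 (a i0 *: u i0) = V i0 (\sum_(j | j != i0) a j *: u j).
  move: a0; rewrite (bigD1 i0)//= => /eqP; rewrite addr_eq0 => /eqP ->.
  by rewrite absvalN.
have ui : 1 - eps <= V i0 (u i0).
  have := ler_absvalB (V i0) 1 (1 - u i0); rewrite absval1 subKr absvalBC.
  by have := (uP i0).1; lra.
have card_le : \sum_(j : 'I_(size S) | j != i0) (ratr `|a i0| * eps : R) <=
    ratr `|a i0| * (eps * (size S)%:R).
  rewrite sumr_const mulrA mulr_natr; apply: ler_wpMn2l.
    by rewrite mulr_ge0 ?ler0q ?(ltW eps0).
  by rewrite -[X in (_ <= X)%N]card_ord max_card.
have a_ge0 : 0 <= (ratr `|a i0| : R) by rewrite ler0q.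
have ai0 : ratr `|a i0| = 0 :> R.
  apply/eqP; rewrite eq_le a_ge0 andbT.
  rewrite -mulr_algl absvalM va in main.
  have m1 : ratr `|a i0| * (1 - eps) <= ratr `|a i0| * (eps * (size S)%:R) :> R.
    apply: le_trans card_le; apply: le_trans rest; rewrite -main.
    by rewrite ler_wpM2l.
  have e1 : eps + eps * (size S)%:R = 2^-1 by rewrite -epsE -natr1; ring.
  have : ratr `|a i0| * (1 - eps - eps * (size S)%:R) <= 0 :> R by lra.
  have -> : 1 - eps - eps * (size S)%:R = 2^-1 by lra.
  by lra.
have {}ai0 : a i0 = 0.
  by apply/eqP; move/eqP: ai0; rewrite fmorph_eq0 normr_eq0.
by apply/eqP; rewrite -normr_le0 (le_trans (imax i))// ai0 normr0.
Qed.

Lemma finite_arch_places : finite_set [set v : absval R K | arch_place v].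
Proof.
apply: contrapT => /(@infinite_set_fset _ _ (dim K).+1)[B Barch].
apply/negP; rewrite -ltnNge ltnS; apply: arch_places_size; first exact: fset_uniq.
by move=> v vB; exact: Barch.
Qed.

End ArchPlaces.

Section EmbeddingMultiplicity.
Context {R : realType} {K : fieldExtType rat}.
Implicit Types (v : absval R K) (f g : {rmorphism K -> complex R}).

Lemma separated_family0 v : separated_family v (fun _ : 'I_0 => 0).
Proof. by exists 1 => // ? []. Qed.

Lemma local_degree_ge1 v : (1 <= local_degree v)%N.
Proof.
apply: (local_degreeP v).2.
apply: (separated_family_cons (separated_family0 v) (x := 1) (d := 1)) => // a.
by rewrite big_ord0 subr0 absval1.
Qed.

(** The pair 1, t is separated, since f t stays at distance at least |Im (f t)| from the
    rationals. *)
Lemma local_degree_nonreal f t : complex.Im (f t) != 0 ->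
  (2 <= local_degree (embedding_absval f))%N.
Proof.
move=> im0; set v := embedding_absval f; apply: (local_degreeP v).2.
have sep1 : separated_family v (fun _ : 'I_1 => 1).
  by exists 1 => // a i; rewrite big_ord1 mul1r (ord1 i).
apply: (separated_family_cons sep1 (x := t) (d := `|complex.Im (f t)|)).
  by rewrite normr_gt0.
move=> a; rewrite big_ord1 /v /= rmorphB.
have -> : f (a ord0)%:A = (ratr (a ord0) : R)%:C%C.
  rewrite -[_%:A]/(in_alg K _) embedding_ratE.
  exact/esym/(fmorph_eq_rat (real_complex R \o ratr)).
rewrite (le_trans _ (normc_ge_Im _))//.
by case: (f t) => x y /=; rewrite oppr0 addr0.
Qed.

(** The moduli at t and at t + 1 determine the real part of the image of t and the square of its
    imaginary part. *)
Lemma embedding_absval_eq f g t : embedding_absval f = embedding_absval g ->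
  f t = g t \/ f t = (complex.Re (g t) -i* complex.Im (g t))%C.
Proof.
move=> fg; have nE x : normc (f x) ^+ 2 = normc (g x) ^+ 2.
  by congr (_ ^+ 2); exact: (congr1 (fun v : absval R K => v x) fg).
have := nE (t + 1); have := nE t; rewrite !rmorphD !rmorph1 !normc_sqr.
case: (f t) (g t) => [a b] [c d] /= e1 e2.
have ac : a = c by lra.
have : (b - d) * (b + d) = 0 by rewrite ac in e1; lra.
move=> /eqP; rewrite mulf_eq0 subr_eq0 addr_eq0 ac => /orP[]/eqP ->; by [left|right].
Qed.

(** Embeddings inducing v agree at t up to conjugation, so there are at most two; if there are two,
    f t is not real and the local degree is at least 2. *)
Lemma embedding_multiplicity v t (s : 'I_(dim K) -> {rmorphism K -> complex R}) :
  injective (fun i => s i t) ->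
  (#|[pred i | embedding_absval (s i) == v]| <= local_degree v)%N.
Proof.
move=> sI; set A := [pred i | _].
have AE i : (i \in A) = (embedding_absval (s i) == v) by [].
have [->//|[i0 i0A]] : #|A| = 0%N \/ exists i0, i0 \in A.
  by have [i0 i0A|A0] := pickP (mem A); [right; exists i0|left; exact: eq_card0].
move: (i0A); rewrite AE => /eqP v0.
pose z := (complex.Re (s i0 t) -i* complex.Im (s i0 t))%C.
have Az i : i \in A -> s i t = s i0 t \/ s i t = z.
  by rewrite AE => /eqP vi; apply: embedding_absval_eq; rewrite vi v0.
have card_le (L : seq (complex R)) : {in A, forall i, s i t \in L} -> (#|A| <= size L)%N.
  move=> AL; rewrite cardE -(size_map (fun i => s i t)); apply: uniq_leq_size.
    by rewrite map_inj_uniq// enum_uniq.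
  by move=> _ /mapP[i iA ->]; apply: AL; rewrite mem_enum in iA.
have [im0|im0] := eqVneq (complex.Im (s i0 t)) 0.
  apply: leq_trans (local_degree_ge1 v); apply: (card_le [:: s i0 t]) => i /Az.
  rewrite inE /z im0 oppr0 => -[->//|->].
  by move: im0; case: (s i0 t) => a b /= ->.
apply: leq_trans (_ : 2 <= _)%N; last by rewrite -v0 (local_degree_nonreal im0).
by apply: (card_le [:: s i0 t; z]) => i /Az[] ->; rewrite !inE eqxx ?orbT.
Qed.

Lemma place_normE v (x : K) : x != 0 ->
  ln (place_norm v x) = (local_degree v)%:R / (dim K)%:R * ln (v x).
Proof. by move=> x0; rewrite /place_norm ln_powR dimvf. Qed.

(** The p-adic places contribute 0 because x is integral. Grouping the embeddings by the archimedean
    place they induce, each place occurs at most local-degree many times, its weight in the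
    height. *)
Lemma height_ge (x : K) t (s : 'I_(dim K) -> {rmorphism K -> complex R})
    (p : {poly int}) :
  p \is monic -> root (map_poly intr p) x -> x != 0 ->
  injective (fun i => s i t) ->
  \sum_i Num.max (ln (normc (s i x))) 0 <= (dim K)%:R * height x :> R.
Proof.
move=> pmon px x0 sI; pose F (v : absval R K) : R := Num.max (ln (v x)) 0.
have dim0 : 0 < (dim K)%:R :> R by rewrite ltr0n -dimvf adim_gt0.
have F0 v : 0 <= F v by rewrite le_max lexx orbT.
pose A := fset_set [set v : absval R K | arch_place v].
have AP v : reflect (arch_place v) (v \in A).
  rewrite in_fset_set; last exact: finite_arch_places.
  by apply: (iffP idP) => [/set_mem|/mem_set].
have GE v : Num.max (ln (place_norm v x)) 0 = (local_degree v)%:R / (dim K)%:R * F v.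
  by rewrite place_normE// /F maxr_pMr ?mulr0// divr_ge0.
rewrite /height (fsbigE A) ?fset_uniq//; last 2 first.
- by move=> v /= /AP; exact: arch_place_place.
- move=> v /placesP[/AP ->//|[q vq] _].
  rewrite GE /F max_r ?mulr0//; apply: ln_le0.
  by apply: integral_absval_le1 pmon px => z; exact: padic_int_le1 vq.
rewrite [X in _ <= _ * X]big_mkcond mulr_sumr /=.
apply: (@le_trans _ _ (\sum_(v <- A) #|[pred i | embedding_absval (s i) == v]|%:R * F v)).
  apply: (@le_trans _ _ (\sum_(v <- A) \sum_(i | embedding_absval (s i) == v) F v)).
    rewrite (exchange_big_dep predT)//=; apply: ler_sum => i _.
    rewrite (eq_bigl (fun v => v == embedding_absval (s i))) => [|v]; last exact: eq_sym.
    rewrite -big_filter filter_pred1_uniq ?fset_uniq ?big_seq1//.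
    by apply/AP; exact: embedding_arch.
  by apply: ler_sum => v _; rewrite sumr_const mulr_natl lexx.
rewrite big_seq [leRHS]big_seq; apply: ler_sum => v vA.
rewrite ifT ?GE; last by rewrite inE; apply/arch_place_place/AP.
rewrite [_ * F v]mulrC mulrA mulrCA mulfV ?gt_eqF// mulr1.
by rewrite mulrC ler_wpM2r// ler_nat; exact: embedding_multiplicity sI.
Qed.

End EmbeddingMultiplicity.

(** * The inequality *)

Lemma ln_pow_diff_prod (R : realType) N (z : complex R) :
  pow_diff_prod N z != 0 -> 
  ln (normc (pow_diff_prod N z)) <=
    N%:R / 2 * ln N%:R + 'C(N.+1, 3)%:R * Num.max (ln (normc z)) 0.
Proof.
move=> P0; case: N => [|N] in P0 *.
  by rewrite /pow_diff_prod big_ord0 normc1 ln1 mul0r mul0r bin_small// mul0r addr0.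
set P := pow_diff_prod _ _ in P0 *.
have nP : 0 < normc P by rewrite lt_def normc_ge0 normc_eq0 P0.
have N0 : 0 < N.+1%:R :> R by rewrite ltr0n.
suff : 2 * ln (normc P) <= N.+1%:R * ln N.+1%:R +
    (2 * 'C(N.+2, 3))%:R * Num.max (ln (normc z)) 0 by rewrite natrM; lra.
have -> : 2 * ln (normc P) = ln (normc P ^+ 2) by rewrite lnXn// mulr_natl.
have [z1|z1] := leP (normc z) 1.
  have bound : normc P ^+ 2 <= N.+1%:R ^+ N.+1.
    have : `|z| <= 1 by rewrite -normc_norm -(rmorph1 (real_complex R)) lecR.
    move=> /(pow_diff_prod_le1 N.+1); rewrite -/P -normc_norm.
    by rewrite -(rmorph_nat (real_complex R)) -!rmorphXn lecR.
  rewrite max_r ?ln_le0// mulr0 addr0 mulr_natl -lnXn//.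
  by rewrite ler_ln ?posrE ?exprn_gt0.
have z0 : 0 < normc z by rewrite (lt_trans ltr01).
have bound : normc P ^+ 2 <= N.+1%:R ^+ N.+1 * normc z ^+ (2 * 'C(N.+2, 3)).
  have : 1 <= `|z| by rewrite -normc_norm -(rmorph1 (real_complex R)) lecR ltW.
  move=> /(pow_diff_prod_ge1 N.+1); rewrite -/P -!normc_norm.
  by rewrite -(rmorph_nat (real_complex R)) -!rmorphXn -rmorphM lecR.
rewrite max_l ?ln_ge0 ?(ltW z1)// !mulr_natl -!lnXn//.
by rewrite -lnM ?posrE ?exprn_gt0// ler_ln ?posrE ?mulr_gt0 ?exprn_gt0.
Qed.

Lemma rmorph_pow_diff_prod (F G : comPzRingType) (f : {rmorphism F -> G}) N z :
  f (pow_diff_prod N z) = pow_diff_prod N (f z).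
Proof.
rewrite /pow_diff_prod rmorph_prod; apply: eq_bigr => j _.
by rewrite rmorph_prod; apply: eq_bigr => i _; rewrite rmorphB rmorphXn rmorph1.
Qed.

Lemma ln_prod (R : realType) (I : eqType) (r : seq I) (F : I -> R) :
  {in r, forall i, 0 < F i} -> ln (\prod_(i <- r) F i) = \sum_(i <- r) ln (F i).
Proof.
elim: r => [|i r IHr] F0; first by rewrite !big_nil ln1.
have Fr : {in r, forall j, 0 < F j} by move=> j jr; apply: F0; rewrite inE jr orbT.
rewrite !big_cons lnM ?IHr// posrE ?F0 ?inE ?eqxx//.
by rewrite big_seq; apply: prodr_gt0.
Qed.

Lemma bin2_natr (R : realType) J : 'C(J.+1, 2)%:R = J%:R * (J%:R + 1) / 2 :> R.
Proof.
elim: J => [|J IHJ]; first by rewrite mul0r mul0r.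
by rewrite binS bin1 natrD IHJ -!natr1; field.
Qed.

Lemma bin3_natr (R : realType) J :
  'C(J.+2, 3)%:R = J%:R * (J%:R + 1) * (J%:R + 2) / 6 :> R.
Proof.
elim: J => [|J IHJ]; first by rewrite !mul0r.
by rewrite binS natrD IHJ bin2_natr -!natr1; field.
Qed.

Section SingleNumber.
Context {R : realType} {K : fieldExtType rat}.
Implicit Types (v : absval R K) (x : K).

Lemma height_ge0 x : 0 <= height x :> R.
Proof. by apply: sumr_ge0 => v _; rewrite le_max lexx orbT. Qed.

Lemma embeddings_height (x : K) t (s : 'I_(dim K) -> {rmorphism K -> complex R})
    (p : {poly int}) :
  p \is monic -> root (map_poly intr p) x -> injective (fun i => s i t) ->
  \sum_i Num.max (ln (normc (s i x))) 0 <= (dim K)%:R * height x :> R.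
Proof.
move=> pmon px sI; have [->|x0] := eqVneq x 0; last exact: height_ge pmon px x0 sI.
rewrite big1 ?mulr_ge0 ?height_ge0// => i _.
by rewrite rmorph0 normc0 ln0// maxxx.
Qed.

Lemma nonarch_pow_sub1_le v (y : K) k : nonarch_places v -> v y <= 1 ->
  v (y ^+ k - 1) <= v (y - 1).
Proof.
move=> nv y1; rewrite subrX1 absvalM ler_piMr ?absval_ge0//.
apply: nonarch_sum => // i; by rewrite absvalX exprn_ile1 ?absval_ge0.
Qed.

Lemma nonarch_pow_diff_prod_le v (y : K) N : nonarch_places v -> v y <= 1 ->
  v (pow_diff_prod N y) <= v (y - 1) ^+ 'C(N, 2).
Proof.
move=> nv y1; rewrite /pow_diff_prod; elim: N => [|N IHN].
  by rewrite big_ord0 absval1.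
rewrite big_ord_recr absvalM binS bin1 exprD ler_pM ?absval_ge0//.
rewrite absval_prod -[in leRHS](card_ord N) -prodr_const ler_prod// => i _.
by rewrite absval_ge0 nonarch_pow_sub1_le.
Qed.

(** Compares two bounds for log |N(b)|, b = P(x^n): from below by the divisibility of b at the
    places of S, from above by the size of b under the embeddings. *)
Lemma place_val_sum_le (iota : {rmorphism K -> algC}) (S : seq (absval R K))
    (m n J : nat) (x : K) :
  uniq S -> {in S, forall v, places_dvd m v} -> (0 < m)%N -> (0 < n)%N -> (0 < J)%N ->
  iota x \in Aint -> (forall k, (0 < k)%N -> x ^+ k != 1) ->
  \sum_(v <- S) place_val v (x ^+ n - 1) <=
    (J%:R + 2) / 3 * n%:R * height x + ln (J%:R + 1) / J%:R.
Proof.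
move=> uS Sm m0 n0 J0 xint xroot; pose y := x ^+ n; pose b := pow_diff_prod J.+1 y.
have yk k : (0 < k)%N -> y ^+ k - 1 != 0.
  by move=> k0; rewrite subr_eq0 /y -exprM xroot// muln_gt0 n0.
have b0 : b != 0.
  by apply/prodf_neq0 => j _; apply/prodf_neq0 => i _; rewrite yk// subn_gt0.
have y10 : y - 1 != 0 by have := yk 1%N isT; rewrite expr1.
have yint : iota y \in Aint by rewrite rmorphXn rpredX.
have bint : iota b \in Aint.
  rewrite rmorph_pow_diff_prod; apply: rpred_prod => j _; apply: rpred_prod => i _.
  by rewrite rpredB ?rpred1 ?rpredX.
have dim0 : 0 < (dim K)%:R :> R by rewrite ltr0n -dimvf adim_gt0.
have [t gen] := num_field_primitive K.
have [s sI] := num_field_embeddings (complex R) gen.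
have [px pxmon pxroot] := Aint_monic_root xint.
have [py pymon pyroot] := Aint_monic_root yint.
have hx := embeddings_height pxmon pxroot sI.
have sb i : 0 < normc (s i b) by rewrite lt_def normc_ge0 normc_eq0 fmorph_eq0 b0.
have detE : ratr `|\det (mul_mx b)| = \prod_i normc (s i b) :> R.
  rewrite -normc_rat (det_mul_mx b sI).
  by apply: (big_morph (@normc R) (@normcM R) (@normc1 R)).
have ln_det : ln (ratr `|\det (mul_mx b)| : R) <=
    (dim K)%:R * (J.+1%:R / 2 * ln J.+1%:R + 'C(J.+2, 3)%:R * n%:R * height x).
  rewrite detE ln_prod//.
  apply: (@le_trans _ _ (\sum_(i < dim K) (J.+1%:R / 2 * ln J.+1%:R +
    'C(J.+2, 3)%:R * n%:R * Num.max (ln (normc (s i x))) 0))).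
    apply: ler_sum => i _; rewrite rmorph_pow_diff_prod.
    apply: le_trans (ln_pow_diff_prod _) _; first by rewrite -rmorph_pow_diff_prod fmorph_eq0.
    rewrite lerD2l -mulrA ler_wpM2l// rmorphXn.
    have -> : normc (s i x ^+ n) = normc (s i x) ^+ n.
      by elim: (n) => [|k IHk]; rewrite ?normc1// !exprS normcM IHk.
    have [->|nx0] := eqVneq (normc (s i x)) 0.
      by rewrite expr0n gtn_eqF// ln0// maxxx mulr0.
    have nx : 0 < normc (s i x) by rewrite lt_def nx0 normc_ge0.
    by rewrite lnXn// maxr_pMr ?mulr0 ?mulr_natl.
  rewrite big_split /= sumr_const card_ord mulrDr [_ * (_ / 2 * _)]mulr_natl lerD2l -mulr_sumr.
  by rewrite mulrCA ler_wpM2l ?mulr_ge0.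
pose C2 : R := 'C(J.+1, 2)%:R.
have C20 : 0 < C2 by rewrite ltr0n bin_gt0.
have y1 v : v \in S -> 0 < v (y - 1) by rewrite absval_gt0 y10.
have vb v : v \in S -> 0 < v b by rewrite absval_gt0 b0.
have lnv v : v \in S -> C2 * - ln (v (y - 1)) <= - ln (v b).
  move=> vS; have nv := (Sm _ vS).1.
  rewrite mulrN lerN2 mulr_natl -lnXn ?y1// ler_ln ?posrE ?exprn_gt0 ?y1 ?vb//.
  apply: nonarch_pow_diff_prod_le => //; have [q vq] := nonarch_padic nv.
  by apply: integral_absval_le1 pymon pyroot => z; exact: padic_int_le1 vq.
have nonarch : 0 <= ln (ratr `|\det (mul_mx b)| : R) +
    \sum_(v <- S) (local_degree v)%:R * ln (v b).
  have det0 : 0 < ratr `|\det (mul_mx b)| :> R by rewrite ltr0q normr_gt0 det_mul_mx_neq0.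
  have := nonarch_norm_bound uS Sm m0 b0 bint => /ln_ge0.
  rewrite lnM ?posrE//; last first.
    by rewrite big_seq; apply: prodr_gt0 => v vS; rewrite exprn_gt0 ?vb.
  rewrite ln_prod => [|v vS]; last by rewrite exprn_gt0 ?vb.
  rewrite big_seq [in X in _ -> X]big_seq.
  by under eq_bigr => v vS do rewrite lnXn ?vb// -mulr_natl.
have sumE : (dim K)%:R * (C2 * \sum_(v <- S) place_val v (y - 1)) <=
    - \sum_(v <- S) (local_degree v)%:R * ln (v b).
  rewrite -sumrN !mulr_sumr big_seq [leRHS]big_seq; apply: ler_sum => v vS.
  rewrite /place_val place_normE// -mulrN.
  have -> : (dim K)%:R * (C2 * ((local_degree v)%:R / (dim K)%:R * - ln (v (y - 1)))) =
      (local_degree v)%:R * (C2 * - ln (v (y - 1))).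
    by field; rewrite gt_eqF.
  by rewrite -[leRHS]mulrN ler_wpM2l ?lnv.
have main : C2 * \sum_(v <- S) place_val v (y - 1) <=
    J.+1%:R / 2 * ln J.+1%:R + 'C(J.+2, 3)%:R * n%:R * height x.
  rewrite -(ler_pM2l dim0); apply: le_trans ln_det; apply: le_trans sumE _.
  by rewrite -subr_ge0 opprK.
(* Dividing by J(J+1)/2 turns 'C(J+2, 3) into (J+2)/3 and (J+1)/2 log(J+1) into log(J+1)/J. *)
rewrite -(ler_pM2l C20); apply: le_trans main _; rewrite le_eqVlt; apply/orP; left; apply/eqP.
rewrite /C2 bin2_natr bin3_natr -natr1; field.
by rewrite pnatr_eq0 -lt0n.
Qed.

End SingleNumber.

Theorem theorem10 (R : realType) (A : {fset algC})
    (A_int : forall a, a \in A -> a \in Aint)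
    (A_nonroot : forall a k, a \in A -> (0 < k)%N -> ~~ k.-unity_root a)
    (m n : nat) (m_ge2 : (2 <= m)%N) (n_ge1 : (1 <= n)%N)
    (K : fieldExtType rat) (iota : {rmorphism K -> algC})
    (A_K : forall a, a \in A -> exists x : K, iota x = a)
    (J : nat) (J_ge1 : (1 <= J)%N) :
  \sum_(a <- A) Qbar_height iota a >=
    3 / (J%:R + 2) *
      (Delta iota A m n * ln (m%:R : R)
       - #|` A|%:R / n%:R * ((ln (J%:R / 2 + 1) + 1) / J%:R)).
Proof.
have m0 : (0 < m)%N by apply: leq_trans m_ge2.
have lnm : ln (m%:R : R) != 0 by rewrite gt_eqF// ln_gt0// ltr1n.
have J0 : 0 < J%:R :> R by rewrite ltr0n.
have n0 : 0 < n%:R :> R by rewrite ltr0n.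
(* Through J + 1 <= J + 2 = 2 (J/2 + 1) and log 2 <= 1. *)
have ln_bound : ln (J%:R + 1 : R) <= ln (J%:R / 2 + 1) + 1.
  have half0 : 0 < J%:R / 2 + 1 :> R by rewrite addr_gt0 ?divr_gt0.
  have ln2 : ln 2 <= 1 :> R by have := @le_ln1Dx R 1; rewrite -(natrD _ 1 1); apply; lra.
  apply: (@le_trans _ _ (ln (2 * (J%:R / 2 + 1)))); last first.
    by rewrite lnM ?posrE// addrC lerD2l.
  have -> : 2 * (J%:R / 2 + 1) = J%:R + 2 :> R by field.
  by rewrite ler_ln ?posrE ?addr_gt0// lerD2l ler1n.
have emb_invK a : a \in A -> iota (emb_inv iota a) = a.
  by move=> /A_K[x xa]; exact: (@xgetPex _ 0 [set x | iota x = a]%classic) (ex_intro _ x xa).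
pose D a : R := \sum_(v \in places_dvd m) n%:R^-1 * place_val v (emb_inv iota a ^+ n - 1).
have key a : a \in A -> D a <= (J%:R + 2) / 3 * Qbar_height iota a +
    (ln (J%:R / 2 + 1) + 1) / J%:R / n%:R.
  move=> aA; set x := emb_inv iota a.
  have xint : iota x \in Aint by rewrite emb_invK// A_int.
  have xroot k : (0 < k)%N -> x ^+ k != 1.
    move=> k0; have := A_nonroot a k aA k0; rewrite unity_rootE -(emb_invK a aA) -rmorphXn.
    by rewrite fmorph_eq1.
  have h0 := @height_ge0 R K x.
  have ln0 : 0 <= ln (J%:R / 2 + 1 : R) by rewrite ln_ge0// lerDr divr_ge0.
  (* A sum of infinite support is 0 by convention, and the right-hand side is nonnegative; otherwise
     the support is a finite set of places dividing m. *)
  rewrite /D; case: finite_supportP => [_|S Sm _ _].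
    rewrite big_nil addr_ge0//; first by rewrite mulr_ge0 ?h0// divr_ge0// addr_ge0.
    by rewrite !divr_ge0// addr_ge0.
  have uS := fset_uniq S.
  have Sm' : {in S, forall v, places_dvd m v} by move=> v vS; exact: Sm.
  rewrite -mulr_sumr mulrC ler_pdivrMr//.
  apply: le_trans (place_val_sum_le uS Sm' m0 n_ge1 J_ge1 xint xroot) _.
  rewrite /Qbar_height -/x [leRHS]mulrDl divfK ?gt_eqF// [X in _ <= X + _]mulrAC lerD2l.
  by rewrite ler_pM2r ?invr_gt0.
have DeltaE : Delta iota A m n * ln (m%:R : R) = \sum_(a <- A) D a.
  by rewrite /Delta mulr_suml; apply: eq_bigr => a _; rewrite mulrAC mulVf ?mul1r.
have J2 : 0 < J%:R + 2 :> R by rewrite addr_gt0.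
have c0 : 0 < (J%:R + 2) / 3 :> R by rewrite divr_gt0.
rewrite DeltaE -(ler_pM2l c0) mulrA.
have -> : (J%:R + 2) / 3 * (3 / (J%:R + 2)) = 1 :> R by field; rewrite gt_eqF.
rewrite mul1r lerBlDr.
apply: (@le_trans _ _ (\sum_(a <- A) ((J%:R + 2) / 3 * Qbar_height iota a +
    (ln (J%:R / 2 + 1) + 1) / J%:R / n%:R))).
  by rewrite big_seq [leRHS]big_seq; apply: ler_sum => a; exact: key.
rewrite big_split /= -mulr_sumr lerD2l big_const_seq count_predT iter_addr_0.
rewrite -[leLHS]mulr_natl le_eqVlt; apply/orP; left; apply/eqP; field.
by rewrite !gt_eqF.
Qed.
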